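(* There are Pontrjagin duality isomorphisms $$R^\infty_{\mathbb{Z}}\cong D\bar P_{\mathbb{Z}_2},\qquad \bar P_{\mathbb{Z}_2}\cong DR^\infty_{\mathbb{Z}}.$$
   Context: The prime is $2$. Work in the category of functors from finite-dimensional $\mathbb{F}_2$-vector spaces to the category $\mathscr{A}b$ of abelian groups. For such a functor $F$, the Pontrjagin dual $DF$ is the functor $DF(V):=\mathrm{Hom}_{\mathscr{A}b}(F(V^\sharp),\mathbb{Z}/2^\infty)$, where $V^\sharp$ is the dual vector space of $V$ and $\mathrm{Hom}_{\mathscr{A}b}$ denotes homomorphisms of abelian groups. $\bar P_{\mathbb{Z}}$ is the functor sending $V$ to the augmentation ideal of the integral group ring $\mathbb{Z}[V]$, and $\bar P_{\mathbb{Z}_2}:=\mathbb{Z}_2\otimes\bar P_{\mathbb{Z}}$, where $\mathbb{Z}_2$ denotes the $2$-adic integers. $\bar P_{\mathbb{Z}}^{\,n}\subset\bar P_{\mathbb{Z}}$ is the image of the iterated product $\bar P_{\mathbb{Z}}^{\otimes n}\to\bar P_{\mathbb{Z}}$ (the $n$-th power of the augmentation ideal), and $R^n_{\mathbb{Z}}:=\bar P_{\mathbb{Z}}/\bar P_{\mathbb{Z}}^{\,n+1}$. The inclusion $2\bar P_{\mathbb{Z}}\hookrightarrow\bar P_{\mathbb{Z}}$, together with the isomorphism $\bar P_{\mathbb{Z}}\cong 2\bar P_{\mathbb{Z}}$ given by multiplication by $2$ (under which $\bar P_{\mathbb{Z}}^{\,n}$ corresponds to $2\bar P_{\mathbb{Z}}\cap\bar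 P_{\mathbb{Z}}^{\,n+1}$), induces monomorphisms $R^{n-1}_{\mathbb{Z}}\hookrightarrow R^n_{\mathbb{Z}}$. $R^\infty_{\mathbb{Z}}$ is the direct limit of the resulting diagram $R^1_{\mathbb{Z}}\hookrightarrow R^2_{\mathbb{Z}}\hookrightarrow R^3_{\mathbb{Z}}\hookrightarrow\cdots$.
   Formalization: In the first isomorphism, the dual of P̄_{Z_2} uses only homomorphisms to Z/2^∞ continuous for the 2-adic topology; with all abelian group homomorphisms it fails at V = F_2, where R^∞ is countable but Hom(Z_2, Z/2^∞) is not. *)

(* Defs.v *)
From HB Require Import structures.
From mathcomp Require Import all_boot all_order all_algebra all_field.
From mathcomp Require Import finmap boolp.
From mathcomp.multinomials Require Import monalg.

Set Implicit Arguments.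
Unset Strict Implicit.
Unset Printing Implicit Defensive.

Import Order.TTheory GRing.Theory Num.Theory Quotient.

Local Open Scope ring_scope.
Local Open Scope quotient_scope.

Section Subgroups.
Variable A : zmodType.

Definition subgrp (S : zmodClosed A) : Type := {x : A | x \in S}.

HB.instance Definition _ (S : zmodClosed A) := SubType.on (subgrp S).
HB.instance Definition _ (S : zmodClosed A) := [Choice of subgrp S by <:].
HB.instance Definition _ (S : zmodClosed A) :=
  [SubChoice_isSubZmodule of subgrp S by <:].

Definition gen (P : A -> Prop) : {pred A} := fun x =>
  `[< forall S : zmodClosed A, (forall y, P y -> y \in S) -> x \in S >].

Fact gen_closed P : zmod_closed (gen P).
Proof.
split=> [|x y /asboolP hx /asboolP hy]; apply/asboolP => S PS; first exact: rpred0.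
by rewrite rpredB ?hx ?hy.
Qed.
HB.instance Definition _ P := GRing.isZmodClosed.Build A (gen P) (gen_closed P).

Lemma mem_gen (P : A -> Prop) x : P x -> x \in gen P.
Proof. by move=> Px; apply/asboolP => S; apply. Qed.

Lemma gen_sub (P : A -> Prop) (S : zmodClosed A) :
  (forall y, P y -> y \in S) -> forall x, x \in gen P -> x \in S.
Proof. by move=> PS x /asboolP; apply. Qed.

End Subgroups.

Section PreimSubgroup.
Variables (A B : zmodType) (f : {additive A -> B}) (T : zmodClosed B).
Definition preimz : {pred A} := fun x => f x \in T.
Fact preimz_closed : zmod_closed preimz.
Proof.
split=> [|x y hx hy]; rewrite -[_ \in _]/(f _ \in T) ?raddf0 ?rpred0 //.
by rewrite raddfB; exact: rpredB.
Qed.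
HB.instance Definition _ := GRing.isZmodClosed.Build A preimz preimz_closed.
End PreimSubgroup.

Section InducedMaps.
Variables (A B : zmodType) (S : zmodClosed A) (T : zmodClosed B).
Variables (f : {additive A -> B}) (fST : forall x, x \in S -> f x \in T).

Definition subgrp_map (x : subgrp S) : subgrp T :=
  exist (fun y => y \in T) (f (val x)) (fST (valP x)).

Fact subgrp_map_additive : zmod_morphism subgrp_map.
Proof. by move=> x y; apply/val_inj; rewrite /= !raddfB. Qed.
HB.instance Definition _ :=
  GRing.isZmodMorphism.Build (subgrp S) (subgrp T) subgrp_map subgrp_map_additive.

Definition quot_map (x : {quot S}) : {quot T} :=
  let _ := fST in \pi_({quot T}) (f (repr x)).

Lemma quot_mapE x : quot_map (\pi_({quot S}) x) = \pi_({quot T}) (f x).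
Proof.
apply/eqP; rewrite /quot_map -idealrBE -raddfB fST // idealrBE.
by rewrite reprK.
Qed.

Fact quot_map_additive : zmod_morphism quot_map.
Proof.
move=> x y; rewrite -[x]reprK -[y]reprK -raddfB !quot_mapE.
by rewrite !raddfB.
Qed.
HB.instance Definition _ :=
  GRing.isZmodMorphism.Build {quot S} {quot T} quot_map quot_map_additive.

End InducedMaps.

Section HomGroup.
Variables A B : zmodType.
Implicit Types f g h : {additive A -> B}.

Lemma additive_ext f g : f =1 g -> f = g.
Proof.
case: f g => [f [[mf]]] [g [[mg]]] /= /funext fg; case: _ / fg in mg *.
by rewrite (Prop_irrelevance mf mg).
Qed.

HB.instance Definition _ := gen_eqMixin {additive A -> B}.
HB.instance Definition _ := gen_choiceMixin {additive A -> B}.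

Definition hom_zero : {additive A -> B} := (\0 : A -> B).
Definition hom_opp f : {additive A -> B} := \- f.
Definition hom_add f g : {additive A -> B} := f \+ g.

Fact hom_addA : associative hom_add.
Proof. by move=> f g h; apply: additive_ext => x /=; rewrite addrA. Qed.
Fact hom_addC : commutative hom_add.
Proof. by move=> f g; apply: additive_ext => x /=; rewrite addrC. Qed.
Fact hom_add0 : left_id hom_zero hom_add.
Proof. by move=> f; apply: additive_ext => x /=; rewrite add0r. Qed.
Fact hom_addN : left_inverse hom_zero hom_opp hom_add.
Proof. by move=> f; apply: additive_ext => x /=; rewrite addNr. Qed.
HB.instance Definition _ := GRing.isZmodule.Build {additive A -> B}
  hom_addA hom_addC hom_add0 hom_addN.

End HomGroup.

Section Precomposition.
Variables (A A' B : zmodType) (f : {additive A' -> A}).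
Definition precomp (g : {additive A -> B}) : {additive A' -> B} := g \o f.
Fact precomp_additive : zmod_morphism precomp.
Proof. by move=> g h; apply: additive_ext. Qed.
HB.instance Definition _ :=
  GRing.isZmodMorphism.Build {additive A -> B} {additive A' -> B} precomp
    precomp_additive.
End Precomposition.

Section Product.
Variable A : nat -> zmodType.

Definition dprod : Type := forall n, A n.
HB.instance Definition _ := gen_eqMixin dprod.
HB.instance Definition _ := gen_choiceMixin dprod.

Definition dprod_zero : dprod := fun n => 0.
Definition dprod_opp (x : dprod) : dprod := fun n => - x n.
Definition dprod_add (x y : dprod) : dprod := fun n => x n + y n.

Fact dprod_addA : associative dprod_add.
Proof. by move=> x y z; apply: functional_extensionality_dep => n; exact: addrA. Qed.
Fact dprod_addC : commutative dprod_add.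
Proof. by move=> x y; apply: functional_extensionality_dep => n; exact: addrC. Qed.
Fact dprod_add0 : left_id dprod_zero dprod_add.
Proof. by move=> x; apply: functional_extensionality_dep => n; exact: add0r. Qed.
Fact dprod_addN : left_inverse dprod_zero dprod_opp dprod_add.
Proof. by move=> x; apply: functional_extensionality_dep => n; exact: addNr. Qed.
HB.instance Definition _ := GRing.isZmodule.Build dprod
  dprod_addA dprod_addC dprod_add0 dprod_addN.

Definition finsupp_seq : {pred dprod} := fun x =>
  `[< exists N, forall n, (N <= n)%N -> x n = 0 >].

Fact finsupp_seq_closed : zmod_closed finsupp_seq.
Proof.
split=> [|x y /asboolP[M hM] /asboolP[N hN]]; apply/asboolP; first by exists 0%N.
exists (maxn M N) => n; rewrite geq_max => /andP[/hM xn /hN yn].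
by rewrite -[LHS]/(x n - y n) xn yn subr0.
Qed.
HB.instance Definition _ :=
  GRing.isZmodClosed.Build dprod finsupp_seq finsupp_seq_closed.

Definition dsum := subgrp finsupp_seq.
HB.instance Definition _ := GRing.Zmodule.on dsum.

Fact dsum_in_subproof n (a : A n) : (dfwith (0 : dprod) a : dprod) \in finsupp_seq.
Proof.
apply/asboolP; exists n.+1 => m; rewrite ltn_neqAle => /andP[nm _].
by rewrite dfwith_out.
Qed.
Definition dsum_in n (a : A n) : dsum :=
  exist (fun x => x \in finsupp_seq) (dfwith (0 : dprod) a) (dsum_in_subproof a).

End Product.

Section ProductMaps.
Variables (A B : nat -> zmodType) (f : forall n, {additive A n -> B n}).

Definition dprod_map (x : dprod A) : dprod B := fun n => f n (x n).
Fact dprod_map_additive : zmod_morphism dprod_map.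
Proof.
by move=> x y; apply: functional_extensionality_dep => n; exact: raddfB.
Qed.
HB.instance Definition _ :=
  GRing.isZmodMorphism.Build (dprod A) (dprod B) dprod_map dprod_map_additive.

Fact dprod_map_finsupp x : x \in @finsupp_seq A -> dprod_map x \in @finsupp_seq B.
Proof.
move=> /asboolP[N xN]; apply/asboolP; exists N => n /xN xn.
by rewrite /dprod_map xn raddf0.
Qed.
Definition dsum_map : {additive dsum A -> dsum B} := subgrp_map dprod_map_finsupp.

Lemma dsum_map_in n (a : A n) : dsum_map (dsum_in a) = dsum_in (f n a).
Proof.
apply/val_inj; apply: functional_extensionality_dep => m /=; rewrite /dprod_map.
have [nm|nm] := eqVneq n m; last by rewrite !dfwith_out // raddf0.
by case: _ / nm; rewrite !dfwith_in.
Qed.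

End ProductMaps.

(* The direct limit of A 0 -> A 1 -> A 2 -> ..., as the direct sum modulo the
   identification of each a in A n with its image in A n.+1. *)
Section DirectLimit.
Variables (A : nat -> zmodType) (phi : forall n, {additive A n -> A n.+1}).

Definition colim_rel (x : dsum A) : Prop :=
  exists n (a : A n), x = dsum_in a - dsum_in (phi n a).

Definition colim := {quot (gen colim_rel)}.
HB.instance Definition _ := GRing.Zmodule.on colim.

Definition colim_in n (a : A n) : colim := \pi_({quot (gen colim_rel)}) (dsum_in a).

End DirectLimit.

Section DirectLimitMap.
Variables (A B : nat -> zmodType).
Variables (phi : forall n, {additive A n -> A n.+1}).
Variables (psi : forall n, {additive B n -> B n.+1}).
Variables (f : forall n, {additive A n -> B n}).
Hypothesis f_phi : forall n a, f n.+1 (phi n a) = psi n (f n a).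

Fact colim_map_subproof x :
  x \in gen (colim_rel phi) -> dsum_map f x \in gen (colim_rel psi).
Proof.
move: x; apply: (gen_sub (S := preimz (dsum_map f) (gen (colim_rel psi)))).
move=> _ [n [a ->]]; rewrite -[_ \in _]/(dsum_map f _ \in gen _) raddfB !dsum_map_in f_phi.
by apply: mem_gen; exists n, (f n a).
Qed.

Definition colim_map : {additive colim phi -> colim psi} :=
  quot_map colim_map_subproof.

Lemma colim_map_in n (a : A n) : colim_map (colim_in phi a) = colim_in psi (f n a).
Proof. by rewrite /colim_in -dsum_map_in; exact: quot_mapE. Qed.

End DirectLimitMap.

Section Tensor.
Variables A B : zmodType.

Definition bilin_rel (x : {malg int[(A * B)%type]}) : Prop :=
  (exists a a' b, x = << (a + a', b) >> - << (a, b) >> - << (a', b) >>) \/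
  (exists a b b', x = << (a, b + b') >> - << (a, b) >> - << (a, b') >>).

Definition tensor := {quot (gen bilin_rel)}.
HB.instance Definition _ := GRing.Zmodule.on tensor.

Definition tens (a : A) (b : B) : tensor := \pi_({quot (gen bilin_rel)}) << (a, b) >>.

End Tensor.

Section FreeMap.
Variables (K L : choiceType) (f : K -> L).

Definition malg_map (x : {malg int[K]}) : {malg int[L]} :=
  \sum_(k <- msupp x) << x@_k *g f k >>.

Lemma malg_mapEw (x : {malg int[K]}) (d : {fset K}) : (msupp x `<=` d)%fset ->
  malg_map x = \sum_(k <- d) << x@_k *g f k >>.
Proof.
move=> xd; rewrite /malg_map (big_fset_incl _ xd) // => k _ kx.
by rewrite mcoeff_outdom // monalgU0.
Qed.

Fact malg_map_additive : zmod_morphism malg_map.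
Proof.
move=> x y; pose d := (msupp x `|` msupp y)%fset.
rewrite (@malg_mapEw (x - y) d) ?msuppB_le // (@malg_mapEw x d) ?fsubsetUl //.
rewrite (@malg_mapEw y d) ?fsubsetUr // -sumrB; apply: eq_bigr => k _.
by rewrite mcoeffB monalgUB.
Qed.
HB.instance Definition _ :=
  GRing.isZmodMorphism.Build {malg int[K]} {malg int[L]} malg_map malg_map_additive.

Lemma malg_mapU k (c : int) : malg_map << c *g k >> = << c *g f k >>.
Proof.
by rewrite (malg_mapEw (d := [fset k]%fset)) ?msuppU_le // big_seq_fset1 mcoeffUU.
Qed.

End FreeMap.

Section TensorMap.
Variables (A B B' : zmodType) (f : {additive B -> B'}).

Let g (p : (A * B)%type) : (A * B')%type := (p.1, f p.2).

Fact tensor_map_subproof x :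
  x \in gen (@bilin_rel A B) -> malg_map g x \in gen (@bilin_rel A B').
Proof.
move: x; apply: (gen_sub (S := preimz (malg_map g) (gen (@bilin_rel A B')))).
move=> _ [[a [a' [b ->]]]|[a [b [b' ->]]]];
  rewrite -[_ \in _]/(malg_map g _ \in gen _) !raddfB /= !malg_mapU;
  apply: mem_gen; [left; exists a, a', (f b)|right; exists a, (f b), (f b')] => //.
by rewrite /g /= raddfD.
Qed.

Definition tensor_map : {additive tensor A B -> tensor A B'} :=
  quot_map tensor_map_subproof.

Lemma tensor_map_tens a b : tensor_map (tens a b) = tens a (f b).
Proof.
by have := quot_mapE tensor_map_subproof << (a, b) >>; rewrite /= malg_mapU.
Qed.

End TensorMap.

(* The additive group Z_2 of 2-adic integers, as the inverse limit of the
   groups Z/2^n over n >= 1 ('Z_(2^0) would not be the trivial group). *)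
Definition Zmod2pow (n : nat) : zmodType := 'Z_(2 ^ n.+1).

Definition Z2_coherent : {pred dprod Zmod2pow} := fun x =>
  `[< forall n, ((x n.+1 : nat) = x n %[mod 2 ^ n.+1])%N >].

Fact val_Zp_sub p (a b : 'Z_p) : (1 < p)%N ->
  ((b < p) /\ ((a - b)%R = (a + (p - b)) %% p :> nat))%N.
Proof.
by case: p a b => [|[|p]] // a b _; split; [exact: ltn_ord|exact: modnDmr].
Qed.

Fact Z2_coherent_closed : zmod_closed Z2_coherent.
Proof.
have gt1 n : (1 < 2 ^ n.+1)%N by rewrite -[1%N]/(2 ^ 0)%N ltn_exp2l.
split=> [|x y /asboolP hx /asboolP hy]; apply/asboolP => n.
  by case: (val_Zp_sub (0 : Zmod2pow n) 0 (gt1 n)) => _; rewrite subrr mod0n.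
rewrite -[(x - y) n.+1]/(x n.+1 - y n.+1) -[(x - y) n]/(x n - y n).
have [/ltnW lt1 ->] := val_Zp_sub (x n.+1) (y n.+1) (gt1 n.+1).
have [/ltnW lt0 ->] := val_Zp_sub (x n) (y n) (gt1 n).
have dv : (2 ^ n.+1 %| 2 ^ n.+2)%N by rewrite dvdn_exp2l.
rewrite modn_dvdm // modn_mod; apply/eqP.
rewrite -(eqn_modDr (y n)) -!addnA subnK // modnDr.
rewrite addnA -modnDmr -hy modnDmr -addnA subnK //.
by rewrite -modnDmr (eqP dv) addn0 hx.
Qed.
HB.instance Definition _ :=
  GRing.isZmodClosed.Build (dprod Zmod2pow) Z2_coherent Z2_coherent_closed.

Definition Zadic2 := subgrp Z2_coherent.
HB.instance Definition _ := GRing.Zmodule.on Zadic2.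

(* Z/2^oo = Z[1/2] / Z. *)
Definition Zhalf_pred : {pred rat} := fun q =>
  `[< exists k, q *+ 2 ^ k \is a Num.int >].

Fact Zhalf_closed : zmod_closed Zhalf_pred.
Proof.
split=> [|x y /asboolP[i xi] /asboolP[j yj]]; apply/asboolP.
  by exists 0%N; rewrite mul0rn rpred0.
exists (i + j)%N; rewrite expnD mulrnBl rpredB //; first by rewrite mulrnA rpredMn.
by rewrite mulnC mulrnA rpredMn.
Qed.
HB.instance Definition _ := GRing.isZmodClosed.Build rat Zhalf_pred Zhalf_closed.

Definition Zhalf := subgrp Zhalf_pred.
HB.instance Definition _ := GRing.Zmodule.on Zhalf.

Definition Zhalf_int : {pred Zhalf} := fun x => val x \is a Num.int.
Fact Zhalf_int_closed : zmod_closed Zhalf_int.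
Proof.
split=> [|x y hx hy]; rewrite -[_ \in _]/(val _ \is a Num.int) ?raddf0 ?rpred0 //.
by rewrite raddfB; exact: rpredB.
Qed.
HB.instance Definition _ := GRing.isZmodClosed.Build Zhalf Zhalf_int Zhalf_int_closed.

Definition Prufer2 := {quot Zhalf_int}.
HB.instance Definition _ := GRing.Zmodule.on Prufer2.

(* Z[G], for a finite additive group G, as the functions G -> Z under
   convolution. *)
Section GroupRing.
Variable G : finZmodType.

Definition gring : Type := {ffun G -> int}.
HB.instance Definition _ := GRing.Zmodule.on gring.
Implicit Types x y z : gring.

Definition gbase (g : G) : gring := [ffun h => (h == g)%:R].
Definition gring_mul x y : gring := [ffun g => \sum_h x h * y (g - h)].

Fact gring_mulC : commutative gring_mul.
Proof.
move=> x y; apply/ffunP => g; rewrite !ffunE.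
rewrite (reindex_inj (inj_comp (addrI g) oppr_inj)) /=.
by apply: eq_bigr => h _; rewrite opprB addrCA subrr addr0 mulrC.
Qed.

Fact gring_mulA : associative gring_mul.
Proof.
move=> x y z; apply/ffunP => g; rewrite !ffunE.
under eq_bigr do rewrite ffunE mulr_sumr.
under [RHS]eq_bigr do rewrite ffunE mulr_suml.
rewrite [RHS]exchange_big /=; apply: eq_bigr => h _.
rewrite [RHS](reindex_inj (addrI h)) /=; apply: eq_bigr => k _.
by rewrite mulrA [h + k]addrC addrK opprD addrA [g - k - h]addrAC.
Qed.

Fact gring_mul1 : left_id (gbase 0) gring_mul.
Proof.
move=> x; apply/ffunP => g; rewrite ffunE (bigD1 0) //= ffunE eqxx mul1r subr0.
by rewrite big1 ?addr0 // => h /negPf h0; rewrite ffunE h0 mul0r.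
Qed.

Fact gring_mulDl : left_distributive gring_mul +%R.
Proof.
move=> x y z; apply/ffunP => g; rewrite !ffunE -big_split /=.
by apply: eq_bigr => h _; rewrite ffunE mulrDl.
Qed.

Fact gring_one_neq0 : gbase 0 != 0.
Proof.
by apply/eqP => /ffunP /(_ 0); rewrite !ffunE eqxx.
Qed.

HB.instance Definition _ := GRing.Zmodule_isComNzRing.Build gring
  gring_mulA gring_mulC gring_mul1 gring_mulDl gring_one_neq0.

Definition aug_ker : {pred gring} := fun x => \sum_g x g == 0.
Fact aug_ker_closed : zmod_closed aug_ker.
Proof.
split=> [|x y]; rewrite !unfold_in; first by rewrite big1 // => g _; rewrite ffunE.
move=> /eqP hx /eqP hy.
by under eq_bigr do rewrite !ffunE; rewrite sumrB hx hy subr0.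
Qed.
HB.instance Definition _ := GRing.isZmodClosed.Build gring aug_ker aug_ker_closed.

Definition augideal := subgrp aug_ker.
HB.instance Definition _ := GRing.Zmodule.on augideal.

(* The image of the n-fold product map from the n-th tensor power consists of
   the sums of n-fold products; only used for n >= 1. *)
Definition aug_power (n : nat) : {pred augideal} :=
  gen (fun u : augideal =>
         exists a : 'I_n -> augideal, val u = \prod_(i < n) val (a i)).
HB.instance Definition _ n := GRing.ZmodClosed.on (aug_power n).

Lemma gbase_mul (g h : G) : gbase g * gbase h = gbase (g + h).
Proof.
apply/ffunP => k; rewrite !ffunE (bigD1 g) //= !ffunE eqxx mul1r big1 ?addr0.
  by rewrite subr_eq addrC.
by move=> l /negPf lg; rewrite ffunE lg mul0r.
Qed.

Lemma gringE x : x = \sum_g gbase g *~ x g.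
Proof.
apply/ffunP => h; rewrite sum_ffunE (bigD1 h) //= big1 => [|g gh].
  by rewrite ffunMzE ffunE eqxx addr0 intz.
by rewrite ffunMzE ffunE eq_sym (negPf gh) mul0rz.
Qed.

Fact aug_kerM x y : x \in aug_ker -> x * y \in aug_ker.
Proof.
move=> /eqP x0; rewrite unfold_in; apply/eqP.
under eq_bigr do rewrite ffunE.
rewrite exchange_big /=.
transitivity ((\sum_g x g) * \sum_g y g); last by rewrite x0 mul0r.
rewrite mulr_suml; apply: eq_bigr => h _; rewrite mulr_sumr (reindex_inj (addIr h)) /=.
by apply: eq_bigr => g _; rewrite addrK.
Qed.

Fact gaug_subproof g : gbase g - gbase 0 \in aug_ker.
Proof.
have sum_gbase h : \sum_k (k == h)%:R = 1 :> int.
  by rewrite (bigD1 h) //= eqxx big1 ?addr0 // => k /negPf ->.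
rewrite unfold_in; under eq_bigr do rewrite !ffunE.
by rewrite sumrB !sum_gbase subrr.
Qed.

Definition gaug g : augideal := exist (fun x => x \in aug_ker) _ (gaug_subproof g).
Definition gaugM g y : augideal :=
  exist (fun x => x \in aug_ker) _ (aug_kerM y (gaug_subproof g)).

Lemma augidealE (u : augideal) : u = \sum_g gaug g *~ val u g.
Proof.
apply/val_inj; rewrite raddf_sum [LHS]gringE.
under [RHS]eq_bigr do rewrite raddfMz /= mulrzBl.
by rewrite sumrB -mulrz_sumr (eqP (valP u)) mulr0z subr0.
Qed.

(* Multiplication by 2 carries the n-th power into the n.+1-st, because
   ([g] - [0])^2 = -2 ([g] - [0]) when 2g = 0. *)
Lemma aug_power_mul2 (n : nat) (u : augideal) : (forall g : G, g + g = 0) ->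
  u \in aug_power n.+1 -> u *+ 2 \in aug_power n.+2.
Proof.
move=> G2; pose d : {additive augideal -> augideal} := idfun \+ idfun.
move: u; apply: (gen_sub (S := preimz d (aug_power n.+2))) => u [a ua].
rewrite -[_ \in _]/(u + u \in aug_power n.+2).
pose r : gring := \prod_(i < n) val (a (lift ord0 i)).
pose t g := gaugM g (val (gaug g) * r).
have sq g : val (gaug g) * val (gaug g) = - (val (gaug g) *+ 2).
  rewrite /= mulrBl !mulrBr !gbase_mul G2 !addr0 add0r opprB addrC mulr2n opprD.
  by rewrite !opprB addrC.
have -> : u + u = - \sum_g t g *~ val (a ord0) g.
  have valt g : val (t g) = - (val (gaug g) * r *+ 2).
    by rewrite -mulrnAl -mulNr -sq -mulrA.
  have valtM g : val (t g *~ val (a ord0) g) = - (val (gaug g) * r *+ 2 *~ val (a ord0) g).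
    by rewrite -mulNrz -valt; exact: raddfMz.
  have vale g : val (gaug g *~ val (a ord0) g) = val (gaug g) *~ val (a ord0) g.
    exact: raddfMz.
  have val0 : val (a ord0) = \sum_g val (gaug g) *~ val (a ord0) g.
    rewrite {1}(augidealE (a ord0)) raddf_sum; apply: eq_bigr => g _; exact: vale.
  apply/val_inj; rewrite raddfN raddf_sum -[LHS]/(val u + val u).
  rewrite [X in _ = - X](eq_bigr _ (fun g _ => valtM g)).
  rewrite sumrN opprK [X in X + X]ua big_ord_recl -/r -mulr2n.
  rewrite [X in X * r]val0 mulr_suml -sumrMnl.
  by apply: eq_bigr => g _; rewrite mulrzAl !mulr2n mulrzDl.
rewrite [_ \in _]rpredN; apply: rpred_sum => g _; apply: rpredMz.
apply: mem_gen; exists (fun i : 'I_n.+2 =>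
  if unlift ord0 i is Some j then
    if unlift ord0 j is Some k then a (lift ord0 k) else gaug g else gaug g).
rewrite !big_ord_recl /= !unlift_none !liftK unlift_none /=; congr (_ * (_ * _)).
by apply: eq_bigr => i _; rewrite !liftK.
Qed.

End GroupRing.

Section GroupRingMap.
Variables (G H : finZmodType) (f : {additive G -> H}).

Definition gring_map (x : gring G) : gring H := [ffun h => \sum_(g | f g == h) x g].

Fact gring_map_additive : zmod_morphism gring_map.
Proof.
move=> x y; apply/ffunP => h; rewrite !ffunE -sumrB.
by apply: eq_bigr => g _; rewrite !ffunE.
Qed.
HB.instance Definition _ :=
  GRing.isZmodMorphism.Build (gring G) (gring H) gring_map gring_map_additive.

Lemma gring_map_base g : gring_map (gbase g) = gbase (f g).
Proof.
apply/ffunP => h; rewrite !ffunE; under eq_bigr do rewrite ffunE.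
have [->|hg] := eqVneq h (f g).
  by rewrite (bigD1 g) //= eqxx big1 ?addr0 // => k /andP[_ /negPf ->].
by rewrite big1 // => k /eqP kh; case: eqP => // kg; rewrite -kh kg eqxx in hg.
Qed.

Fact gring_map_monoid : monoid_morphism gring_map.
Proof.
split=> [|x y]; first by rewrite gring_map_base raddf0.
rewrite [x]gringE [y]gringE.
rewrite !(mulr_suml, mulr_sumr, raddf_sum); apply: eq_bigr => g _.
rewrite !(mulr_suml, mulr_sumr, raddf_sum); apply: eq_bigr => h _.
by rewrite !(raddfMz, mulrzAl, mulrzAr) /= !gring_map_base !gbase_mul gring_map_base raddfD.
Qed.
HB.instance Definition _ :=
  GRing.isMonoidMorphism.Build (gring G) (gring H) gring_map gring_map_monoid.

Fact gring_map_aug x : x \in @aug_ker G -> gring_map x \in @aug_ker H.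
Proof.
move=> /eqP x0; rewrite unfold_in; under eq_bigr do rewrite ffunE.
apply/eqP; transitivity (\sum_g x g); last exact: x0.
by rewrite [RHS](partition_big f xpredT).
Qed.
Definition augideal_map : {additive augideal G -> augideal H} :=
  subgrp_map gring_map_aug.

Fact augideal_map_power n (u : augideal G) :
  u \in @aug_power G n -> augideal_map u \in @aug_power H n.
Proof.
move: u; apply: (gen_sub (S := preimz augideal_map (@aug_power H n))) => u [a ua].
apply: mem_gen; exists (fun i => augideal_map (a i)).
by rewrite /= ua rmorph_prod.
Qed.

End GroupRingMap.

Section Pointwise.

Lemma subgrp_map_id (A : zmodType) (S : zmodClosed A) (f : {additive A -> A})
    (h : forall x, x \in S -> f x \in S) :
  (forall x, f x = x) -> forall x, subgrp_map h x = x.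
Proof. by move=> fE x; apply/val_inj; rewrite /= fE. Qed.

Lemma subgrp_map_comp (A B C : zmodType) (S : zmodClosed A) (T : zmodClosed B)
    (U : zmodClosed C) (f : {additive A -> B}) (g : {additive B -> C})
    (k : {additive A -> C}) (hf : forall x, x \in S -> f x \in T)
    (hg : forall x, x \in T -> g x \in U) (hk : forall x, x \in S -> k x \in U) :
  (forall x, k x = g (f x)) ->
  forall x, subgrp_map hk x = subgrp_map hg (subgrp_map hf x).
Proof. by move=> kE x; apply/val_inj; rewrite /= kE. Qed.

Lemma quot_map_id (A : zmodType) (S : zmodClosed A) (f : {additive A -> A})
    (h : forall x, x \in S -> f x \in S) :
  (forall x, f x = x) -> forall x, quot_map h x = x.
Proof. by move=> fE x; rewrite -[x]reprK quot_mapE fE. Qed.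

Lemma quot_map_comp (A B C : zmodType) (S : zmodClosed A) (T : zmodClosed B)
    (U : zmodClosed C) (f : {additive A -> B}) (g : {additive B -> C})
    (k : {additive A -> C}) (hf : forall x, x \in S -> f x \in T)
    (hg : forall x, x \in T -> g x \in U) (hk : forall x, x \in S -> k x \in U) :
  (forall x, k x = g (f x)) ->
  forall x, quot_map hk x = quot_map hg (quot_map hf x).
Proof. by move=> kE x; rewrite -[x]reprK (quot_mapE hf) !quot_mapE kE. Qed.

Lemma malg_map_id (K : choiceType) (f : K -> K) :
  (forall k, f k = k) -> forall x, malg_map f x = x.
Proof.
by move=> fE x; rewrite [RHS]monalgE; apply: eq_bigr => k _; rewrite fE.
Qed.

Lemma malg_map_comp (K L M : choiceType) (f : K -> L) (g : L -> M) (h : K -> M) :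
  (forall k, h k = g (f k)) -> forall x, malg_map h x = malg_map g (malg_map f x).
Proof.
move=> hE x; rewrite [malg_map f x]/malg_map raddf_sum.
by apply: eq_bigr => k _; rewrite /= malg_mapU hE.
Qed.

End Pointwise.

Record abfunctor := AbFunctor {
  fobj :> vectType 'F_2 -> zmodType;
  fmap : forall V W : vectType 'F_2, 'Hom(V, W) -> {additive fobj V -> fobj W};
  fmap_id : forall (V : vectType 'F_2) x, fmap (\1%VF : 'Hom(V, V)) x = x;
  fmap_comp : forall (U V W : vectType 'F_2) (g : 'Hom(V, W)) (f : 'Hom(U, V)) x,
    fmap (g \o f)%VF x = fmap g (fmap f x)
}.

Definition fiso (F G : abfunctor) : Prop :=
  exists eta : forall V, {additive F V -> G V},
    (forall V, bijective (eta V)) /\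
    (forall (V W : vectType 'F_2) (f : 'Hom(V, W)) x,
       eta W (fmap F f x) = fmap G f (eta V x)).

Definition fin_vect (V : vectType 'F_2) : finZmodType := finvect_type V.

Definition fin_lfun (V W : vectType 'F_2) (f : 'Hom(V, W)) :
  {additive fin_vect V -> fin_vect W} := (f : V -> W).

Lemma fin_vect2 (V : vectType 'F_2) (v : fin_vect V) : v + v = 0.
Proof.
have two0 : 1 + 1 = 0 :> 'F_2 by apply/val_inj.
by rewrite -[LHS]/((v : V) + (v : V)) -[v : V]scale1r -scalerDl two0 scale0r.
Qed.

Section AugmentationIdealFunctor.

Definition PbarZ_obj (V : vectType 'F_2) : zmodType := augideal (fin_vect V).
Definition PbarZ_map (V W : vectType 'F_2) (f : 'Hom(V, W)) :
  {additive PbarZ_obj V -> PbarZ_obj W} := augideal_map (fin_lfun f).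

Fact PbarZ_id (V : vectType 'F_2) x : PbarZ_map (\1%VF : 'Hom(V, V)) x = x.
Proof.
apply: subgrp_map_id x => x; apply/ffunP => v; rewrite ffunE.
by rewrite (big_pred1 v) // => w; rewrite /= lfunE.
Qed.

Fact PbarZ_comp (U V W : vectType 'F_2) (g : 'Hom(V, W)) (f : 'Hom(U, V)) x :
  PbarZ_map (g \o f)%VF x = PbarZ_map g (PbarZ_map f x).
Proof.
apply: subgrp_map_comp x => x; rewrite [x]gringE !raddf_sum.
apply: eq_bigr => u _; rewrite !raddfMz /= !gring_map_base.
by rewrite /= lfunE.
Qed.

Definition PbarZ := AbFunctor PbarZ_id PbarZ_comp.

Definition PbarZ2_obj (V : vectType 'F_2) : zmodType := tensor Zadic2 (PbarZ V).
Definition PbarZ2_map (V W : vectType 'F_2) (f : 'Hom(V, W)) :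
  {additive PbarZ2_obj V -> PbarZ2_obj W} := tensor_map Zadic2 (fmap PbarZ f).

Fact PbarZ2_id (V : vectType 'F_2) x : PbarZ2_map (\1%VF : 'Hom(V, V)) x = x.
Proof.
apply: quot_map_id x => x; apply: malg_map_id => -[a b].
by congr (_, _); exact: fmap_id.
Qed.

Fact PbarZ2_comp (U V W : vectType 'F_2) (g : 'Hom(V, W)) (f : 'Hom(U, V)) x :
  PbarZ2_map (g \o f)%VF x = PbarZ2_map g (PbarZ2_map f x).
Proof.
apply: quot_map_comp x => x; apply: malg_map_comp => -[a b].
by congr (_, _); exact: fmap_comp.
Qed.

Definition PbarZ2 := AbFunctor PbarZ2_id PbarZ2_comp.

End AugmentationIdealFunctor.

Section PassiFunctors.

(* RZ n is the quotient of PbarZ by its n.+1-st power. *)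
Definition RZ_obj (n : nat) (V : vectType 'F_2) : zmodType :=
  {quot (@aug_power (fin_vect V) n.+1)}.

Definition RZ_map n (V W : vectType 'F_2) (f : 'Hom(V, W)) :
    {additive RZ_obj n V -> RZ_obj n W} :=
  quot_map (@augideal_map_power _ _ (fin_lfun f) n.+1).

Fact RZ_id n (V : vectType 'F_2) x : RZ_map n (\1%VF : 'Hom(V, V)) x = x.
Proof. by apply: quot_map_id x => x; exact: fmap_id PbarZ _ _. Qed.

Fact RZ_comp n (U V W : vectType 'F_2) (g : 'Hom(V, W)) (f : 'Hom(U, V)) x :
  RZ_map n (g \o f)%VF x = RZ_map n g (RZ_map n f x).
Proof. by apply: quot_map_comp x => x; exact: fmap_comp PbarZ _ _ _ _ _ _. Qed.

Definition RZ n := AbFunctor (@RZ_id n) (@RZ_comp n).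

(* RZ n -> RZ n.+1, induced by multiplication by 2 on the augmentation ideal. *)
Definition dbl (A : zmodType) : {additive A -> A} := idfun \+ idfun.

Fact RZ_incl_subproof n V (u : augideal (fin_vect V)) :
  u \in @aug_power _ n.+1 -> dbl _ u \in @aug_power _ n.+2.
Proof. exact: aug_power_mul2 (@fin_vect2 V). Qed.

Definition RZ_incl n V : {additive RZ n V -> RZ n.+1 V} :=
  quot_map (@RZ_incl_subproof n V).

Fact RZ_incl_natural n (V W : vectType 'F_2) (f : 'Hom(V, W)) x :
  fmap (RZ n.+1) f (RZ_incl n V x) = RZ_incl n W (fmap (RZ n) f x).
Proof.
rewrite -[x]reprK [RZ_incl n V _]quot_mapE [fmap (RZ n) f _]quot_mapE.
by rewrite [LHS]quot_mapE [RHS]quot_mapE /= raddfD.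
Qed.

(* The direct limit starts at RZ 1. *)
Definition RZinf_obj (V : vectType 'F_2) : zmodType :=
  colim (fun n => RZ_incl n.+1 V).

Definition RZinf_map (V W : vectType 'F_2) (f : 'Hom(V, W)) :
    {additive RZinf_obj V -> RZinf_obj W} :=
  colim_map (fun n => @RZ_incl_natural n.+1 V W f).

Fact RZinf_id (V : vectType 'F_2) x : RZinf_map (\1%VF : 'Hom(V, V)) x = x.
Proof.
apply: quot_map_id x => x; apply: subgrp_map_id x => x.
by apply: functional_extensionality_dep => n; exact: fmap_id.
Qed.

Fact RZinf_comp (U V W : vectType 'F_2) (g : 'Hom(V, W)) (f : 'Hom(U, V)) x :
  RZinf_map (g \o f)%VF x = RZinf_map g (RZinf_map f x).
Proof.
apply: quot_map_comp x => x; apply: subgrp_map_comp x => x.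
by apply: functional_extensionality_dep => n; exact: fmap_comp.
Qed.

Definition RZinf := AbFunctor RZinf_id RZinf_comp.

End PassiFunctors.

Section Duality.

Definition dual_vect (V : vectType 'F_2) : vectType 'F_2 := 'Hom(V, ('F_2)^o).

Section Transpose.
Variables (V W : vectType 'F_2) (f : 'Hom(V, W)).
Definition transpose_fun (l : dual_vect W) : dual_vect V := (l \o f)%VF.
Fact transpose_linear : linear transpose_fun.
Proof.
by move=> k l m; rewrite /transpose_fun comp_lfunDl comp_lfunZl.
Qed.
HB.instance Definition _ :=
  GRing.isLinear.Build 'F_2 (dual_vect W) (dual_vect V) _ transpose_fun
    transpose_linear.
Definition transpose : 'Hom(dual_vect W, dual_vect V) := linfun transpose_fun.
End Transpose.

Lemma transpose_id (V : vectType 'F_2) : transpose (\1%VF : 'Hom(V, V)) = \1%VF.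
Proof. by apply/lfunP => l; rewrite !lfunE /= /transpose_fun comp_lfun1r. Qed.

Lemma transpose_comp (U V W : vectType 'F_2) (g : 'Hom(V, W)) (f : 'Hom(U, V)) :
  transpose (g \o f)%VF = (transpose f \o transpose g)%VF.
Proof. by apply/lfunP => l; rewrite !lfunE /= !lfunE /= /transpose_fun comp_lfunA. Qed.

Variable F : abfunctor.

Definition D_obj (V : vectType 'F_2) : zmodType :=
  {additive F (dual_vect V) -> Prufer2}.
Definition D_map (V W : vectType 'F_2) (f : 'Hom(V, W)) :
  {additive D_obj V -> D_obj W} := precomp (fmap F (transpose f)).

Fact D_id (V : vectType 'F_2) x : D_map (\1%VF : 'Hom(V, V)) x = x.
Proof. by apply: additive_ext => u; rewrite /= transpose_id fmap_id. Qed.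

Fact D_comp (U V W : vectType 'F_2) (g : 'Hom(V, W)) (f : 'Hom(U, V)) x :
  D_map (g \o f)%VF x = D_map g (D_map f x).
Proof. by apply: additive_ext => u; rewrite /= transpose_comp fmap_comp. Qed.

Definition D := AbFunctor D_id D_comp.

(* The homomorphisms A -> Z/2^oo that are continuous for the 2-adic topology of
   A (with basis 2^k A of neighbourhoods of 0) and the discrete one of Z/2^oo. *)
Definition adic_cont (A : zmodType) : {pred {additive A -> Prufer2}} := fun f =>
  `[< exists k, forall x : A, f (x *+ 2 ^ k) = 0 >].

Fact adic_cont_closed (A : zmodType) : zmod_closed (@adic_cont A).
Proof.
split=> [|f g /asboolP[i fi] /asboolP[j gj]]; apply/asboolP; first by exists 0%N.
exists (i + j)%N => x.
rewrite -[LHS]/(f (x *+ 2 ^ (i + j)) - g (x *+ 2 ^ (i + j))) expnD.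
by rewrite [X in g (_ *+ X)]mulnC !mulrnA mulrnAC fi [X in g X]mulrnAC gj subrr.
Qed.
HB.instance Definition _ (A : zmodType) :=
  GRing.isZmodClosed.Build {additive A -> Prufer2} (@adic_cont A)
    (@adic_cont_closed A).

Definition Dadic_obj (V : vectType 'F_2) : zmodType :=
  subgrp (@adic_cont (F (dual_vect V))).

Fact Dadic_subproof (V W : vectType 'F_2) (f : 'Hom(V, W)) x :
  x \in @adic_cont (F (dual_vect V)) -> D_map f x \in @adic_cont (F (dual_vect W)).
Proof.
move=> /asboolP[k xk]; apply/asboolP; exists k => u.
by rewrite /= raddfMn xk.
Qed.

Definition Dadic_map (V W : vectType 'F_2) (f : 'Hom(V, W)) :
  {additive Dadic_obj V -> Dadic_obj W} := subgrp_map (@Dadic_subproof V W f).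

Fact Dadic_id (V : vectType 'F_2) x : Dadic_map (\1%VF : 'Hom(V, V)) x = x.
Proof. by apply: subgrp_map_id x => x; exact: D_id. Qed.

Fact Dadic_comp (U V W : vectType 'F_2) (g : 'Hom(V, W)) (f : 'Hom(U, V)) x :
  Dadic_map (g \o f)%VF x = Dadic_map g (Dadic_map f x).
Proof. by apply: subgrp_map_comp x => x; exact: D_comp. Qed.

(* The Pontrjagin dual of a functor whose values carry the 2-adic topology, as
   those of PbarZ2 do, while D is the dual of a functor with discrete values.
   The distinction matters: there are uncountably many discontinuous
   homomorphisms from Z_2 to Z/2^oo, while the continuous ones, equivalently
   the Z_2-linear ones, form Z/2^oo. *)
Definition Dadic := AbFunctor Dadic_id Dadic_comp.

End Duality.

(* Main.v *)
From HB Require Import structures.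
From mathcomp Require Import all_boot all_order all_algebra.
From mathcomp Require Import finmap boolp.
From mathcomp.multinomials Require Import monalg.
Require Import Defs.

Set Implicit Arguments.
Unset Strict Implicit.
Unset Printing Implicit Defensive.

Import Order.TTheory GRing.Theory Num.Theory Quotient.

Local Open Scope ring_scope.
Local Open Scope quotient_scope.

(** Write I(V) for the augmentation ideal of Z[V].  Sending u in the n-th stage
    of the direct limit to u / 2^n identifies the limit with I(V)[1/2] modulo
    the union L of the 2^-n I(V)^(n+2).  The Fourier transform, which evaluates
    an element of Z[V] at the characters (-1)^l for l in the dual space, is
    injective, and it sends [v] - [0] to the function l |-> -2 l(v), where l(v)
    is read as 0 or 1.  Products of n such functions are (-2)^n times products
    of functions l |-> l(v), and these products span all integer functions
    vanishing at l = 0.  Hence L becomes 4 times the lattice of such functions,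
    and the limit becomes the group of functions from the dual space to Z/2^oo
    that vanish at 0.

    This is made explicit by a pairing of the limit with the characters l of V,
    (u / 2^n, l) |-> (sum_v u(v) l(v)) / 2^(n+1) in Z/2^oo ([char_pair]).  It is
    well defined because the Fourier transform is multiplicative
    ([bitclass_power]).  The elements [fourier_delta], products of enough
    elements [v] - [0] whose transform is supported at a single character, show
    that the values of the pairing can be prescribed at will away from 0
    ([char_pair_onto]); together with Fourier injectivity they also show that
    the pairing detects every element of the limit ([char_pair_inj]).

    Both isomorphisms follow.  A functional on Z_2 (x) I(V^#) that is continuous
    is Z_2-linear, so it amounts to arbitrary values on the basis [l] - [0],
    l <> 0: this is the description of the limit just found.  Conversely a
    functional on the limit for V^# is a family, indexed by the nonzero elements
    v of V seen as characters of V^#, of endomorphisms of Z/2^oo.  Each of them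
    is multiplication by a 2-adic integer ([prufer_endo]), so the family is an
    element of Z_2 (x) I(V).  The two cases use one theory of the pairing, for a
    finite group X of characters in perfect duality with V ([perfect]). *)

(** * Homomorphisms out of quotients, tensor products and direct limits *)

Section QuotientLift.
Variables (A P : zmodType) (S : zmodClosed A) (f : {additive A -> P}).
Hypothesis fS : forall x, x \in S -> f x = 0.

(* Mentioning [fS] makes it a parameter of the constant, from which the additivity
   instance is inferred. *)
Definition quot_lift (x : {quot S}) : P := let _ := fS in f (repr x).

Lemma quot_liftE x : quot_lift (\pi_({quot S}) x) = f x.
Proof.
apply/eqP; rewrite -subr_eq0 -raddfB fS //.
by rewrite idealrBE reprK.
Qed.

Fact quot_lift_additive : zmod_morphism quot_lift.
Proof.
by move=> x y; rewrite -[x]reprK -[y]reprK -raddfB !quot_liftE raddfB.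
Qed.
HB.instance Definition _ :=
  GRing.isZmodMorphism.Build {quot S} P quot_lift quot_lift_additive.

End QuotientLift.

Lemma kills_gen (A P : zmodType) (R : A -> Prop) (f : {additive A -> P}) :
  (forall x, R x -> f x = 0) -> forall x, x \in gen R -> f x = 0.
Proof.
move=> fR x /asboolP hx.
pose K : {pred A} := fun x => f x == 0.
have K0 : zmod_closed K.
  by split=> [|a b /eqP fa /eqP fb]; apply/eqP; rewrite ?raddf0 ?raddfB ?fa ?fb ?subrr.
pose Km := GRing.isZmodClosed.Build A K K0.
pose KS : zmodClosed A := HB.pack K Km.
by apply/eqP; apply: (hx KS) => y /fR fy; apply/eqP.
Qed.

Section FreeLift.
Variables (K : choiceType) (P : zmodType) (phi : K -> P).

Definition malg_lift (x : {malg int[K]}) : P := \sum_(k <- msupp x) phi k *~ x@_k.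

Lemma malg_liftEw (x : {malg int[K]}) (d : {fset K}) : (msupp x `<=` d)%fset ->
  malg_lift x = \sum_(k <- d) phi k *~ x@_k.
Proof.
move=> xd; rewrite /malg_lift (big_fset_incl _ xd) // => k _ kx.
by rewrite mcoeff_outdom // mulr0z.
Qed.

Fact malg_lift_additive : zmod_morphism malg_lift.
Proof.
move=> x y; pose d := (msupp x `|` msupp y)%fset.
rewrite (@malg_liftEw (x - y) d) ?msuppB_le // (@malg_liftEw x d) ?fsubsetUl //.
rewrite (@malg_liftEw y d) ?fsubsetUr // -sumrB; apply: eq_bigr => k _.
by rewrite mcoeffB mulrzBr.
Qed.
HB.instance Definition _ :=
  GRing.isZmodMorphism.Build {malg int[K]} P malg_lift malg_lift_additive.

Lemma malg_liftU k : malg_lift << k >> = phi k.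
Proof.
by rewrite (malg_liftEw (d := [fset k]%fset)) ?msuppU_le // big_seq_fset1 mcoeffUU.
Qed.

End FreeLift.

Section TensorLift.
Variables (A B P : zmodType) (beta : A -> B -> P).
Hypothesis betaDl : forall a a' b, beta (a + a') b = beta a b + beta a' b.
Hypothesis betaDr : forall a b b', beta a (b + b') = beta a b + beta a b'.

Fact tensor_lift_subproof x : x \in gen (@bilin_rel A B) ->
  malg_lift (fun p => beta p.1 p.2) x = 0.
Proof.
move: x; apply: kills_gen => _ [[a [a' [b ->]]]|[a [b [b' ->]]]];
  by rewrite !raddfB /= !malg_liftU /= (betaDl, betaDr) addrAC addrK subrr.
Qed.

Definition tensor_lift : {additive tensor A B -> P} := quot_lift tensor_lift_subproof.

Lemma tensor_lift_tens a b : tensor_lift (tens a b) = beta a b.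
Proof.
by have := quot_liftE tensor_lift_subproof << (a, b) >>; rewrite /= malg_liftU.
Qed.

End TensorLift.

Section TensorTheory.
Variables A B : zmodType.

Let bilin_relP (x y z : {malg int[(A * B)%type]}) : bilin_rel (x - y - z) ->
  \pi_(tensor A B) x = \pi_(tensor A B) y + \pi_(tensor A B) z.
Proof.
move=> h; rewrite -raddfD; apply/eqP; rewrite -idealrBE opprD addrA.
exact: mem_gen.
Qed.

Fact tens_additive_r (a : A) : zmod_morphism (@tens A B a).
Proof.
move=> b c; apply/eqP; rewrite eq_sym subr_eq; apply/eqP/bilin_relP; right.
by exists a, (b - c), c; rewrite subrK.
Qed.
HB.instance Definition _ (a : A) :=
  GRing.isZmodMorphism.Build B (tensor A B) (@tens A B a) (tens_additive_r a).

Definition tensl (b : B) : A -> tensor A B := fun a => tens a b.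
Fact tensl_additive (b : B) : zmod_morphism (tensl b).
Proof.
move=> a c; apply/eqP; rewrite eq_sym subr_eq; apply/eqP/bilin_relP; left.
by exists (a - c), c, b; rewrite subrK.
Qed.
HB.instance Definition _ (b : B) :=
  GRing.isZmodMorphism.Build A (tensor A B) (tensl b) (tensl_additive b).

(** Closure under differences is the form that is immediate when Q is an equality
    of additive maps; zero and sums are recovered from it. *)
Lemma tensor_ind (Q : tensor A B -> Prop) :
  (forall x y, Q x -> Q y -> Q (x - y)) -> (forall a b, Q (tens a b)) ->
  forall x, Q x.
Proof.
move=> QB Qt x; rewrite -[x]reprK [repr x]monalgE raddf_sum.
have Q0 : Q 0 by rewrite -(subrr (tens 0 0)); apply: QB.
have QD u v : Q u -> Q v -> Q (u + v).
  by move=> Qu Qv; rewrite -[v]opprK -[- v]sub0r; apply: (QB) => //; apply: QB.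
apply: (big_ind Q) => // -[a b] _.
set c := _@_ _; rewrite -[c]intz (raddfMz (mkmalgU (a, b))) raddfMz.
rewrite -[X in Q (X *~ _)]/(tens a b) -(raddfMz (tens a)); exact: Qt.
Qed.

Lemma tensor_ext (P : zmodType) (f g : {additive tensor A B -> P}) :
  (forall a b, f (tens a b) = g (tens a b)) -> f =1 g.
Proof. by move=> fg; apply: tensor_ind => // x y fx fy; rewrite !raddfB fx fy. Qed.

End TensorTheory.

Section DsumTheory.
Variable A : nat -> zmodType.

Lemma dsum_in_at n (a : A n) : val (dsum_in a) n = a.
Proof. by rewrite /= dfwith_in. Qed.

Lemma dsum_in_off n (a : A n) m : n != m -> val (dsum_in a) m = 0.
Proof. by move=> nm; rewrite /= dfwith_out. Qed.

Fact dsum_in_additive n : zmod_morphism (@dsum_in A n).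
Proof.
move=> a b; apply/val_inj; apply: functional_extensionality_dep => m.
rewrite raddfB -[RHS]/(val (dsum_in a) m - val (dsum_in b) m).
have [<-|nm] := eqVneq n m; first by rewrite !dsum_in_at.
by rewrite !dsum_in_off ?subrr.
Qed.
HB.instance Definition _ n :=
  GRing.isZmodMorphism.Build (A n) (dsum A) (@dsum_in A n) (@dsum_in_additive n).

Lemma dsum_bound (x : dsum A) : exists N, forall n, (N <= n)%N -> val x n = 0.
Proof. by have /asboolP := valP x. Qed.

Lemma dsumE (x : dsum A) N : (forall n, (N <= n)%N -> val x n = 0) ->
  x = \sum_(n < N) dsum_in (val x n).
Proof.
move=> xN; apply/val_inj; apply: functional_extensionality_dep => m.
rewrite raddf_sum.
have -> : (\sum_(i < N) val (dsum_in (val x i))) m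
        = \sum_(i < N) val (dsum_in (val x i)) m :> A m.
  by elim/big_rec2: _ => // i u v _ <-.
have [mN|Nm] := ltnP m N.
  rewrite (bigD1 (Ordinal mN)) //= dfwith_in big1 ?addr0 // => i im.
  by rewrite dfwith_out.
rewrite big1 ?xN // => i _; rewrite dsum_in_off //.
by rewrite neq_ltn (leq_trans (ltn_ord i) Nm).
Qed.

Section Lift.
Variables (P : zmodType) (f : forall n, {additive A n -> P}).

Definition dsum_lift (x : dsum A) : P :=
  \sum_(n < sval (cid (dsum_bound x))) f n (val x n).

Lemma dsum_liftEw (x : dsum A) N : (forall n, (N <= n)%N -> val x n = 0) ->
  dsum_lift x = \sum_(n < N) f n (val x n).
Proof.
rewrite /dsum_lift; case: cid => M /= xM xN.
wlog MN : M N xM xN / (M <= N)%N.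
  by move=> h; case/orP: (leq_total M N) => /h -> //.
rewrite -!(big_mkord xpredT (fun n => f n (val x n))) [RHS](big_cat_nat (n := M)) //=.
rewrite [X in _ = _ + X]big_nat [X in _ + X]big1 ?addr0 // => i /andP[Mi _].
by rewrite xM // raddf0.
Qed.

Fact dsum_lift_additive : zmod_morphism dsum_lift.
Proof.
move=> x y; have [M xM] := dsum_bound x; have [N yN] := dsum_bound y.
rewrite (@dsum_liftEw x (maxn M N)) => [|n]; last by rewrite geq_max => /andP[/xM ->].
rewrite (@dsum_liftEw y (maxn M N)) => [|n]; last by rewrite geq_max => /andP[_ /yN ->].
rewrite (@dsum_liftEw (x - y) (maxn M N)) => [|n]; last first.
  rewrite geq_max => /andP[/xM xn /yN yn].
  by rewrite -[LHS]/(val x n - val y n) xn yn subrr.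
rewrite -sumrB; apply: eq_bigr => i _.
by rewrite -raddfB.
Qed.
HB.instance Definition _ :=
  GRing.isZmodMorphism.Build (dsum A) P dsum_lift dsum_lift_additive.

Lemma dsum_lift_in n (a : A n) : dsum_lift (dsum_in a) = f n a.
Proof.
rewrite (@dsum_liftEw _ n.+1) => [|m nm]; last by rewrite dsum_in_off // ltn_eqF.
rewrite big_ord_recr /= dfwith_in big1 ?add0r // => i _.
by rewrite dfwith_out ?raddf0 // gtn_eqF.
Qed.

End Lift.
End DsumTheory.

Section ColimTheory.
Variables (A : nat -> zmodType) (phi : forall n, {additive A n -> A n.+1}).

Fact colim_in_additive n : zmod_morphism (@colim_in A phi n).
Proof. by move=> a b; rewrite /colim_in raddfB raddfB. Qed.
HB.instance Definition _ n :=
  GRing.isZmodMorphism.Build (A n) (colim phi) (@colim_in A phi n)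
    (@colim_in_additive n).

Lemma colim_in_succ n (a : A n) : colim_in phi (phi n a) = colim_in phi a.
Proof.
apply/esym/eqP; rewrite /colim_in -idealrBE; apply: mem_gen.
by exists n, a.
Qed.

Lemma colim_in_le n m (a : A n) : (n <= m)%N ->
  exists b : A m, colim_in phi a = colim_in phi b.
Proof.
elim: m => [|m IH]; first by case: n a => // a _; exists a.
rewrite leq_eqVlt => /orP[/eqP nm|/IH [b ->]]; first by case: _ / nm; exists a.
by exists (phi m b); rewrite colim_in_succ.
Qed.

(** Finitely many elements of various stages can be pushed to a common one. *)
Lemma colimP (x : colim phi) : exists n (a : A n), x = colim_in phi a.
Proof.
have QB n m (a : A n) (b : A m) :
    exists k (c : A k), colim_in phi a + colim_in phi b = colim_in phi c.
  have [a' ->] := colim_in_le a (leq_maxl n m).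
  have [b' ->] := colim_in_le b (leq_maxr n m).
  by exists (maxn n m), (a' + b'); rewrite raddfD.
rewrite -[x]reprK; have [N xN] := dsum_bound (repr x).
rewrite (dsumE xN) raddf_sum.
apply: (big_ind (fun x : colim phi => exists n (a : A n), x = colim_in phi a)).
- by exists 0%N, 0; rewrite raddf0.
- by move=> _ _ [n [a ->]] [m [b ->]]; apply: QB.
by move=> i _; exists i, (val (repr x) i).
Qed.

Variables (P : zmodType) (f : forall n, {additive A n -> P}).
Hypothesis f_phi : forall n a, f n.+1 (phi n a) = f n a.

Fact colim_lift_subproof x : x \in gen (colim_rel phi) -> dsum_lift f x = 0.
Proof.
move: x; apply: kills_gen => _ [n [a ->]].
by rewrite raddfB /= !dsum_lift_in f_phi subrr.
Qed.

Definition colim_lift : {additive colim phi -> P} := quot_lift colim_lift_subproof.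

Lemma colim_lift_in n (a : A n) : colim_lift (colim_in phi a) = f n a.
Proof.
by have := quot_liftE colim_lift_subproof (dsum_in a); rewrite /= dsum_lift_in.
Qed.

End ColimTheory.

(** * The 2-adic integers as the endomorphism ring of the Pruefer group *)

Section Prufer.

Fact proot_subproof k : ((2 ^ k)%:R)^-1 \in Zhalf_pred.
Proof.
by apply/asboolP; exists k; rewrite -[X in X \is a _]mulr_natr mulVf ?rpred1 //
  pnatr_eq0 expn_eq0.
Qed.

(** The class of 1/2^k. *)
Definition proot k : Prufer2 :=
  \pi_({quot Zhalf_int}) (exist (fun q => q \in Zhalf_pred) _ (proot_subproof k)).

Lemma prufer_eq0 (q : Zhalf) :
  (\pi_({quot Zhalf_int}) q == 0) = (val q \is a Num.int).
Proof. by rewrite -[0](raddf0 \pi) -idealrBE subr0. Qed.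

Lemma proot_double k : proot k.+1 *+ 2 = proot k.
Proof.
apply/eqP; rewrite -raddfMn -idealrBE -[_ \in _]/(val _ \is a Num.int).
rewrite raddfB raddfMn /= expnS natrM invfM -mulrnAl.
by rewrite -[2^-1 *+ 2]mulr_natr mulVf // mul1r subrr rpred0.
Qed.

Lemma proot_mul k j : proot (j + k) *+ 2 ^ j = proot k.
Proof.
by elim: j => [|j IH]; rewrite ?mulr1n // addSn expnS mulrnA proot_double.
Qed.

Lemma proot_eq0 k m : (proot k *+ m == 0) = (2 ^ k %| m)%N.
Proof.
rewrite -raddfMn prufer_eq0 raddfMn /=.
rewrite -[_ *+ m]mulr_natl; apply/idP/idP => [/intrP[n hn]|/dvdnP[n ->]].
  have: m%:Z = n * (2 ^ k)%N.
    apply: (@intr_inj rat); rewrite rmorphM /= -hn -[RHS]mulrA mulVf ?mulr1 //.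
    by rewrite pnatr_eq0 expn_eq0.
  by move=> mn; have := dvdz_mull n (dvdzz (2 ^ k)%N); rewrite -mn dvdzE.
by rewrite natrM -mulrA mulfV ?mulr1 ?rpred_nat // pnatr_eq0 expn_eq0.
Qed.

Lemma proot_ann k : proot k *+ 2 ^ k = 0.
Proof. by apply/eqP; rewrite proot_eq0. Qed.

Lemma prufer_tors (p : Prufer2) : exists k, p *+ 2 ^ k = 0.
Proof.
rewrite -[p]reprK; have /asboolP[k hk] := valP (repr p); exists k.
by apply/eqP; rewrite -raddfMn prufer_eq0 raddfMn.
Qed.

Lemma proot_span k (p : Prufer2) : p *+ 2 ^ k = 0 -> exists m, p = proot k *+ m.
Proof.
rewrite -[p]reprK; set q := repr p => /eqP; rewrite -raddfMn prufer_eq0 raddfMn.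
move=> /intrP[c hc]; pose r := (c %% (2 ^ k)%N)%Z.
have r0 : 0 <= r by rewrite modz_ge0 // eqz_nat expn_eq0.
exists `|r|%N; rewrite -raddfMn.
apply/eqP; rewrite -idealrBE -[_ \in _]/(val _ \is a Num.int) raddfB raddfMn /=.
have nz : (2 ^ k)%:R != 0 :> rat by rewrite pnatr_eq0 expn_eq0.
have -> : val q = c%:~R / (2 ^ k)%:R by rewrite -hc -[_ *+ (2 ^ k)]mulr_natr mulfK.
rewrite -[_ *+ `|r|]mulr_natl -mulrBl natr_absz ger0_norm //.
rewrite {1}(divz_eq c (2 ^ k)%N) -/r rmorphD /= addrK rmorphM /=.
by rewrite -mulrA mulfV // mulr1 rpred_int.
Qed.

Lemma prufer_tors_mono (p : Prufer2) k j : (k <= j)%N -> p *+ 2 ^ k = 0 -> p *+ 2 ^ j = 0.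
Proof. by move=> /subnK <- pk; rewrite expnD mulnC mulrnA pk mul0rn. Qed.

Lemma prufer_tors_fin (I : finType) (phi : I -> Prufer2) :
  exists k, forall i, phi i *+ 2 ^ k = 0.
Proof.
have [k hk] := choice (fun i => prufer_tors (phi i)).
exists (\max_i k i)%N => i; apply: prufer_tors_mono (hk i).
exact: leq_bigmax.
Qed.

End Prufer.

Section TwoAdicAction.

Lemma mulrn_mod (A : zmodType) (p : A) d m : p *+ d = 0 -> p *+ (m %% d) = p *+ m.
Proof. by move=> pd; rewrite {2}(divn_eq m d) mulrnDr mulnC mulrnA pd mul0rn add0r. Qed.

(** The representative in [0, 2^(n+1)) of z modulo 2^(n+1). *)
Definition digit (z : Zadic2) (n : nat) : nat := val z n.

Lemma pow2_gt1 n : (1 < 2 ^ n.+1)%N.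
Proof. by rewrite -[1%N]/(2 ^ 0)%N ltn_exp2l. Qed.

Lemma Zp_cast2 n : ((Zp_trunc (2 ^ n.+1)).+2 = 2 ^ n.+1)%N.
Proof. exact: Zp_cast (pow2_gt1 n). Qed.

Lemma digit_lt z n : (digit z n < 2 ^ n.+1)%N.
Proof. by rewrite -[X in (_ < X)%N]Zp_cast2 ltn_ord. Qed.

Lemma digitD z w n : digit (z + w) n = ((digit z n + digit w n) %% 2 ^ n.+1)%N.
Proof. by rewrite -[X in (_ %% X)%N]Zp_cast2. Qed.

Lemma digit0 n : digit 0 n = 0%N. Proof. by []. Qed.

Lemma digit_succ z n : (digit z n.+1 %% 2 ^ n.+1 = digit z n)%N.
Proof.
have /asboolP /(_ n) := valP z; rewrite -!/(digit z _) => ->.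
by rewrite modn_small // digit_lt.
Qed.

Lemma digit_le z n m : (n <= m)%N -> (digit z m %% 2 ^ n.+1 = digit z n)%N.
Proof.
elim: m => [|m IH]; first by case: n => // _; rewrite modn_small // digit_lt.
rewrite leq_eqVlt => /orP[/eqP ->|nm]; first by rewrite modn_small ?digit_lt.
by rewrite -(IH nm) -(digit_succ z m) modn_dvdm // dvdn_exp2l.
Qed.

Lemma digit_inj z w : digit z =1 digit w -> z = w.
Proof.
move=> zw; apply/val_inj/functional_extensionality_dep => n.
by apply/val_inj; exact: zw.
Qed.

Section Build.
Variable s : nat -> nat.
Hypothesis s_coh : forall n, (s n.+1 = s n %[mod 2 ^ n.+1])%N.
Definition seq_dprod : dprod Zmod2pow := fun n => inZp (s n).
Fact seq_coherent : seq_dprod \in Z2_coherent.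
Proof.
apply/asboolP => n; rewrite /seq_dprod /= !Zp_cast2.
by rewrite modn_dvdm ?dvdn_exp2l // s_coh modn_mod.
Qed.
Definition Z2_of_seq : Zadic2 := exist (fun x => x \in Z2_coherent) _ seq_coherent.
Lemma digit_of_seq n : digit Z2_of_seq n = (s n %% 2 ^ n.+1)%N.
Proof. by rewrite /digit /= Zp_cast2. Qed.
End Build.

Definition Z2_one : Zadic2 := @Z2_of_seq (fun=> 1%N) (fun=> erefl).

Definition torsion_exp (p : Prufer2) : nat := sval (cid (prufer_tors p)).

(** The Z_2-module structure of Z/2^oo: an element killed by 2^k is multiplied by
    any integer congruent to z modulo 2^k. *)
Definition zact (z : Zadic2) (p : Prufer2) : Prufer2 := p *+ digit z (torsion_exp p).

Lemma zactE z p k : p *+ 2 ^ k = 0 -> zact z p = p *+ digit z k.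
Proof.
have stable i j : p *+ 2 ^ i = 0 -> (i <= j)%N -> p *+ digit z j = p *+ digit z i.
  by move=> pi ij; rewrite -(digit_le z ij) mulrn_mod // expnS mulnC mulrnA pi mul0rn.
rewrite /zact /torsion_exp; case: cid => j /= pj pk.
by case/orP: (leq_total j k) => jk; [rewrite (stable j k) | rewrite (stable k j)].
Qed.

Lemma zact1 p : zact Z2_one p = p.
Proof.
have [k pk] := prufer_tors p; rewrite (zactE _ pk) digit_of_seq.
by rewrite modn_small ?pow2_gt1.
Qed.

Lemma zactDr z p q : zact z (p + q) = zact z p + zact z q.
Proof.
have [k pk] := prufer_tors_fin (fun b : bool => if b then p else q).
rewrite (zactE z (pk true)) (zactE z (pk false)) (@zactE z (p + q) k) ?mulrnDl //.
by rewrite (pk true) (pk false) addr0.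
Qed.

Lemma zactDl z w p : zact (z + w) p = zact z p + zact w p.
Proof.
have [k pk] := prufer_tors p; rewrite !(zactE _ pk) digitD -mulrnDr mulrn_mod //.
by rewrite expnS mulnC mulrnA pk mul0rn.
Qed.

Fact zact_additive z : zmod_morphism (zact z).
Proof. by move=> p q; apply/eqP; rewrite eq_sym subr_eq -zactDr subrK. Qed.
HB.instance Definition _ z :=
  GRing.isZmodMorphism.Build Prufer2 Prufer2 (zact z) (zact_additive z).

Definition zactl p z := zact z p.
Fact zactl_additive p : zmod_morphism (zactl p).
Proof. by move=> z w; apply/eqP; rewrite eq_sym subr_eq /zactl -zactDl subrK. Qed.
HB.instance Definition _ p :=
  GRing.isZmodMorphism.Build Zadic2 Prufer2 (zactl p) (zactl_additive p).

Lemma proot_inj k m n : (proot k *+ m == proot k *+ n) = (m == n %[mod 2 ^ k])%N.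
Proof.
wlog nm : m n / (n <= m)%N.
  by move=> h; case/orP: (leq_total m n) => /h //; rewrite eq_sym => ->; rewrite eq_sym.
by rewrite -subr_eq0 -mulrnBr // proot_eq0 eqn_mod_dvd.
Qed.

Lemma zact_proot z n : zact z (proot n.+1) = proot n.+1 *+ digit z n.
Proof.
apply/eqP; rewrite (zactE _ (proot_ann _)) proot_inj -(digit_le z (leqnSn n)).
by rewrite modn_mod.
Qed.

Lemma zact_faithful z : (forall p, zact z p = 0) -> z = 0.
Proof.
move=> z0; apply: digit_inj => n; rewrite digit0.
have := z0 (proot n.+1); rewrite zact_proot => /eqP; rewrite proot_eq0 => /eqP.
by rewrite modn_small // digit_lt.
Qed.

(** An endomorphism multiplies the generator 1/2^(n+1) of the 2^(n+1)-torsion by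
    an integer defined modulo 2^(n+1); compatibility with doubling makes these
    integers coherent. *)
Lemma prufer_endo (f : {additive Prufer2 -> Prufer2}) : exists z, f =1 zact z.
Proof.
have f_ann n : f (proot n.+1) *+ 2 ^ n.+1 = 0 by rewrite -raddfMn proot_ann raddf0.
have [s sE] := choice (fun n => proot_span (f_ann n)).
have s_coh n : (s n.+1 = s n %[mod 2 ^ n.+1])%N.
  apply/eqP; rewrite -proot_inj -sE -{2}proot_double raddfMn sE.
  by rewrite -mulrnA mulnC mulrnA proot_double.
exists (Z2_of_seq s_coh) => p; have [k pk] := prufer_tors p.
have [m ->] := proot_span (prufer_tors_mono (leqnSn k) pk).
rewrite !raddfMn /= sE zact_proot digit_of_seq; congr (_ *+ _).
by apply/eqP; rewrite proot_inj modn_mod.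
Qed.

(** The integers are dense in Z_2, with 2^k Z_2 as neighbourhoods of 0: the
    quotient w has the digits of z shifted by k binary places. *)
Lemma Z2_divmod z k : exists w, z = Z2_one *+ (digit z k %% 2 ^ k) + w *+ 2 ^ k.
Proof.
have d_coh n : ((digit z (n.+1 + k) %/ 2 ^ k)
    = (digit z (n + k) %/ 2 ^ k) %[mod 2 ^ n.+1])%N.
  rewrite !modn_divl -expnD addSn digit_succ.
  by rewrite modn_small // digit_lt.
exists (Z2_of_seq d_coh); apply: digit_inj => n.
have digitMn w m : digit (w *+ m) n = ((digit w n * m) %% 2 ^ n.+1)%N.
  elim: m => [|m IH]; first by rewrite muln0 mod0n.
  by rewrite mulrS digitD IH modnDmr mulnS.
rewrite digitD !digitMn !digit_of_seq !modnMml !modnDml !modnDmr.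
have -> : (digit z k %% 2 ^ k = digit z (n + k) %% 2 ^ k)%N.
  by rewrite -(digit_le z (leq_addl n k)) modn_dvdm // dvdn_exp2l.
by rewrite mul1n addnC -divn_eq digit_le // leq_addr.
Qed.

(** Continuity forces Z_2-linearity, because f factors through Z_2 / 2^k, which is
    generated by the class of 1. *)
Lemma Z2_hom_cont (f : {additive Zadic2 -> Prufer2}) k :
  (forall z, f (z *+ 2 ^ k) = 0) -> forall z, f z = zact z (f Z2_one).
Proof.
move=> fk z.
have f1 : f Z2_one *+ 2 ^ k = 0 by rewrite -raddfMn fk.
have [w {1}->] := Z2_divmod z k.
by rewrite (zactE _ f1) raddfD fk addr0 raddfMn mulrn_mod.
Qed.

End TwoAdicAction.

(** * Characters of elementary abelian 2-groups *)

Section Characters.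

Lemma F2_cases (c : 'F_2) : (c = 0) + (c = 1).
Proof. by case: c => [[|[|//]]] h; [left|right]; apply/val_inj. Qed.

Definition F2sign (c : 'F_2) : int := (-1) ^+ (c : nat).

Lemma F2signD c d : F2sign (c + d) = F2sign c * F2sign d.
Proof. by case: (F2_cases c) => ->; case: (F2_cases d) => ->. Qed.

Lemma F2signE c : F2sign c = 1 - (c : nat)%:Z *+ 2.
Proof. by case: (F2_cases c) => ->. Qed.

Variables (G : finZmodType) (c : {additive G -> 'F_2}).

Definition fourier (a : gring G) : int := \sum_g a g * F2sign (c g).

Fact fourier_additive : zmod_morphism fourier.
Proof.
by move=> a b; rewrite -sumrB; apply: eq_bigr => g _; rewrite !ffunE mulrBl.
Qed.
HB.instance Definition _ :=
  GRing.isZmodMorphism.Build (gring G) int fourier fourier_additive.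

Lemma fourier_base g : fourier (gbase g) = F2sign (c g).
Proof.
rewrite /fourier (bigD1 g) //= ffunE eqxx mul1r big1 ?addr0 // => h /negPf hg.
by rewrite ffunE hg mul0r.
Qed.

Fact fourier_monoid : monoid_morphism fourier.
Proof.
split=> [|a b]; first by rewrite fourier_base raddf0.
rewrite /fourier mulr_suml.
under eq_bigr do rewrite ffunE mulr_suml.
rewrite exchange_big; apply: eq_bigr => g _ /=.
rewrite mulr_sumr (reindex_inj (addrI g)); apply: eq_bigr => h _ /=.
by rewrite [g + h]addrC addrK raddfD F2signD [F2sign _ * _]mulrC mulrACA.
Qed.
HB.instance Definition _ :=
  GRing.isMonoidMorphism.Build (gring G) int fourier fourier_monoid.

(** Minus half the Fourier transform of u, by [fourier_aug]. *)
Definition bitsum (u : augideal G) : int := \sum_g val u g * (c g : nat)%:Z.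

Fact bitsum_additive : zmod_morphism bitsum.
Proof.
move=> a b; rewrite -sumrB; apply: eq_bigr => g _.
by rewrite raddfB -mulrBl; congr (_ * _); rewrite !ffunE.
Qed.
HB.instance Definition _ :=
  GRing.isZmodMorphism.Build (augideal G) int bitsum bitsum_additive.

Lemma fourier_aug u : fourier (val u) = - 2 * bitsum u.
Proof.
rewrite /fourier; under eq_bigr do rewrite F2signE mulrBr mulr1.
rewrite sumrB (eqP (valP u)) sub0r mulNr mulr_sumr; congr (- _).
by apply: eq_bigr => g _; rewrite mulrnAr mulr_natl.
Qed.

Definition bitclass n (u : augideal G) : Prufer2 := proot n *~ bitsum u.
Fact bitclass_additive n : zmod_morphism (bitclass n).
Proof. by move=> a b; rewrite /bitclass raddfB mulrzBr. Qed.
HB.instance Definition _ n :=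
  GRing.isZmodMorphism.Build (augideal G) Prufer2 (bitclass n) (bitclass_additive n).

(** A product of n+1 augmentation elements has Fourier coefficient divisible by
    2^(n+1), one factor 2 for each; the factor 2 of [fourier_aug] leaves a
    divisibility by 2^n for [bitsum]. *)
Lemma bitclass_power n u : u \in @aug_power G n.+1 -> bitclass n u = 0.
Proof.
move: u; apply: kills_gen => u [a ua].
have : bitsum u = (- 2) ^+ n * \prod_(i < n.+1) bitsum (a i).
  apply: (@mulfI _ (- 2)) => //; rewrite mulrA -exprS -fourier_aug ua rmorph_prod /=.
  under eq_bigr do rewrite fourier_aug.
  by rewrite big_split prodr_const card_ord.
rewrite /= /bitclass => ->; rewrite -mulrN1 exprMn -mulrA mulrzA -natrX.
by rewrite natz -pmulrn proot_ann mul0rz.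
Qed.

End Characters.

Lemma bitclass_double (G : finZmodType) (c : {additive G -> 'F_2}) n u :
  bitclass c n.+1 (dbl _ u) = bitclass c n u.
Proof.
by rewrite raddfD /bitclass -mulr2n pmulrn -mulrzA mulrC mulrzA -pmulrn proot_double.
Qed.

Section PerfectPairing.
Variables X G : finZmodType.

(** X is identified with the dual group of G, and then G with that of X: the two
    separation conditions play symmetric roles, so that both V^# acting on V and V
    acting on V^# are covered. *)
Definition perfect (chi : X -> {additive G -> 'F_2}) : Prop :=
  [/\ forall g, zmod_morphism (chi ^~ g),
      forall x, (forall g, chi x g = 0) -> x = 0
    & forall g, (forall x, chi x g = 0) -> g = 0].

Variable chi : X -> {additive G -> 'F_2}.
Hypothesis chi_perfect : perfect chi.

Lemma perfectD x y g : chi (x + y) g = chi x g + chi y g.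
Proof.
have [chiB _ _] := chi_perfect.
by apply/eqP; rewrite -subr_eq; have := chiB g (x + y) y; rewrite addrK => ->.
Qed.

Lemma perfectB x y g : chi (x - y) g = chi x g - chi y g.
Proof. by have [chiB _ _] := chi_perfect; exact: (chiB g). Qed.

Lemma perfect0 g : chi 0 g = 0.
Proof. by rewrite -(subrr 0) perfectB subrr. Qed.

Lemma perfect_detect x : x != 0 -> exists g, chi x g = 1.
Proof.
have [_ chi_sep _] := chi_perfect => x0; apply: contrapT => none.
case/eqP: x0; apply: chi_sep => g; case: (F2_cases (chi x g)) => // xg.
by case: none; exists g.
Qed.

(** Orthogonality: translation by a y with chi y g = 1 changes the sign of the
    sum. *)
Lemma F2signsum g : g != 0 -> \sum_x F2sign (chi x g) = 0.
Proof.
have [_ _ chi_sep] := chi_perfect => g0.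
have [y yg] : exists y, chi y g = 1.
  apply: contrapT => none; case/eqP: g0; apply: chi_sep => x.
  by case: (F2_cases (chi x g)) => // xg; case: none; exists x.
have: \sum_x F2sign (chi x g) = - \sum_x F2sign (chi x g).
  rewrite {1}(reindex_inj (addIr y)) -sumrN; apply: eq_bigr => x _.
  by rewrite perfectD F2signD yg mulrN1.
by move/eqP; rewrite -addr_eq0 -mulr2n mulrn_eq0 => /eqP.
Qed.

(** Fourier inversion recovers #|X| * a from the transform of a. *)
Lemma fourier_inj (a : gring G) : (forall x, fourier (chi x) a = 0) -> a = 0.
Proof.
move=> a0; apply/ffunP => h; rewrite [RHS]ffunE.
have : \sum_x fourier (chi x) a * F2sign (chi x (- h)) = a h * #|X|%:R.
  rewrite /fourier; under eq_bigr do rewrite mulr_suml.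
  rewrite exchange_big (bigD1 h) //= [X in _ + X]big1 ?addr0 => [|g gh].
    rewrite -sum1_card natr_sum mulr_sumr; apply: eq_bigr => x _.
    by rewrite -mulrA -F2signD raddfN subrr.
  under eq_bigr do rewrite -mulrA -F2signD -raddfD.
  by rewrite -mulr_sumr F2signsum ?mulr0 // subr_eq0.
rewrite big1 => [/esym/eqP|x _]; last by rewrite a0 mul0r.
rewrite mulf_eq0 => /orP[/eqP //|].
by rewrite pnatr_eq0 => /pred0P/(_ 0).
Qed.

Lemma bitsum_inj (u w : augideal G) :
  (forall x, bitsum (chi x) u = bitsum (chi x) w) -> u = w.
Proof.
move=> uw; apply/eqP; rewrite -subr_eq0; apply/eqP/val_inj/fourier_inj => x.
by rewrite fourier_aug raddfB /= uw subrr mulr0.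
Qed.

(** An element distinguishing y from x might take the value 1 at y instead of at x;
    adding an element w with chi x w = 1 then corrects it, unless w already does
    the job. *)
Lemma separating_elements x : x != 0 -> exists v : X -> G, forall y,
  chi x (v y) = 1 /\ (y != x -> chi y (v y) = 0).
Proof.
move=> x0; have [w xw] := perfect_detect x0.
suff /choice[v vP] : forall y, exists g, chi x g = 1 /\ (y != x -> chi y g = 0).
  by exists v.
move=> y.
have [->|yx] := eqVneq y x; first by exists w.
have := yx; rewrite -subr_eq0 => /perfect_detect[g]; rewrite perfectB => yxg.
have [xg|xg] := F2_cases (chi x g).
  have yg : chi y g = 1 by move: yxg; rewrite xg subr0.
  have [yw|yw] := F2_cases (chi y w); first by exists w.
  exists (g + w); rewrite !raddfD xg xw yg yw add0r; split=> // _.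
  exact/val_inj.
exists g; split=> // _.
by case: (F2_cases (chi y g)) yxg => // ->; rewrite xg subrr.
Qed.

Lemma aug_prod n (a : 'I_n -> augideal G) : (0 < n)%N ->
  exists2 u, u \in @aug_power G n & val u = \prod_(i < n) val (a i).
Proof.
case: n a => // n a _.
exists (exist (fun z => z \in @aug_ker G) _
          (aug_kerM (\prod_(i < n) val (a (lift ord0 i))) (valP (a ord0)))).
  by apply: mem_gen; exists a; rewrite big_ord_recl.
by rewrite big_ord_recl.
Qed.

(** The product over all y of the elements gaug (v y) of [separating_elements]: at
    y <> x the factor of index y vanishes, while at x every factor is -2. *)
Lemma fourier_delta x : x != 0 ->
  exists2 e, e \in @aug_power G #|X| &
    forall y, fourier (chi y) (val e) = (- 2) ^+ #|X| *+ (y == x).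
Proof.
move=> x0; have [v vP] := separating_elements x0.
have [|e eP eE] := @aug_prod #|X| (fun i => gaug (v (enum_val i))).
  by apply/card_gt0P; exists 0.
exists e => // y; rewrite eE rmorph_prod /=.
have gaugE z : fourier (chi y) (val (gaug z)) = - 2 * (chi y z : nat)%:Z.
  rewrite raddfB /= !fourier_base raddf0 F2signE [F2sign 0]expr0 addrAC subrr.
  by rewrite sub0r mulNr mulr_natl.
under eq_bigr do rewrite gaugE.
have [->|yx] := eqVneq y x.
  under eq_bigr do rewrite (vP _).1 mulr1.
  by rewrite prodr_const card_ord.
rewrite (bigD1 (enum_rank y)) //= enum_rankK (vP y).2 // mulr0 mul0r.
by [].
Qed.

End PerfectPairing.

(** * The pairing of the direct limit with the characters of V *)

Section LimitClasses.
Variable V : vectType 'F_2.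

(** The class of u / 2^n. *)
Definition limit_class n (u : PbarZ V) : RZinf V :=
  colim_in (fun n => RZ_incl n.+1 V) (\pi_(RZ_obj n.+1 V) u).

Fact limit_class_additive n : zmod_morphism (@limit_class n).
Proof. by move=> u w; rewrite /limit_class !raddfB. Qed.
HB.instance Definition _ n :=
  GRing.isZmodMorphism.Build (PbarZ V) (RZinf V) (@limit_class n)
    (@limit_class_additive n).

Lemma limit_class_double n u : limit_class n.+1 (dbl _ u) = limit_class n u.
Proof.
etransitivity; last exact: (colim_in_succ (fun n => RZ_incl n.+1 V)).
apply: (congr1 (@colim_in _ (fun n => RZ_incl n.+1 V) n.+1)).
exact/esym/(quot_mapE (@RZ_incl_subproof n.+1 V)).
Qed.

Lemma limit_class_mul n m u : limit_class (m + n) (u *+ 2 ^ m) = limit_class n u.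
Proof.
elim: m => [|m IH]; first by rewrite mulr1n.
rewrite addSn expnSr mulrnA mulr2n -IH -[RHS]limit_class_double.
by [].
Qed.

Lemma limit_classP (y : RZinf V) : exists n u, y = limit_class n u.
Proof.
have [n [a ->]] := colimP y; exists n, (repr a).
by rewrite /limit_class reprK.
Qed.

Lemma limit_class_power n u : u \in @aug_power (fin_vect V) n.+2 ->
  limit_class n u = 0.
Proof.
move=> uP; rewrite /limit_class; have -> : \pi_(RZ_obj n.+1 V) u = 0.
  by rewrite -(raddf0 \pi); apply/eqP; rewrite -idealrBE subr0.
exact: raddf0.
Qed.

Lemma aug_power_mul_pow2 n m (u : augideal (fin_vect V)) :
  u \in @aug_power (fin_vect V) n.+1 -> u *+ 2 ^ m \in @aug_power (fin_vect V) (m + n).+1.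
Proof.
move=> uP; elim: m => [|m IH]; first by rewrite mulr1n.
by rewrite expnSr mulrnA; apply: aug_power_mul2 => //; exact: fin_vect2.
Qed.

Section Pairing.
Variable c : {additive fin_vect V -> 'F_2}.

Definition stage_pair n : {additive RZ n.+1 V -> Prufer2} :=
  quot_lift (@bitclass_power _ c n.+1).

Lemma stage_pairE n u : stage_pair n (\pi_(RZ_obj n.+1 V) u) = bitclass c n.+1 u.
Proof. exact: (quot_liftE (@bitclass_power _ c n.+1)). Qed.

Fact stage_pair_incl n (a : RZ n.+1 V) :
  stage_pair n.+1 (RZ_incl n.+1 V a) = stage_pair n a.
Proof.
rewrite -[a]reprK [RZ_incl _ _ _]quot_mapE !stage_pairE.
exact: bitclass_double.
Qed.

Definition char_pair : {additive RZinf V -> Prufer2} := colim_lift stage_pair_incl.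

Lemma char_pair_class n u : char_pair (limit_class n u) = bitclass c n.+1 u.
Proof.
have := colim_lift_in stage_pair_incl (\pi_(RZ_obj n.+1 V) u).
by rewrite stage_pairE.
Qed.

End Pairing.

End LimitClasses.

Lemma bitsum_map (G H : finZmodType) (f : {additive G -> H})
    (c : {additive G -> 'F_2}) (d : {additive H -> 'F_2}) :
  (forall g, c g = d (f g)) -> forall u, bitsum d (augideal_map f u) = bitsum c u.
Proof.
move=> cd u; rewrite /bitsum; under eq_bigr do rewrite ffunE mulr_suml.
rewrite [RHS](partition_big f xpredT) //=; apply: eq_bigr => h _.
by apply: eq_bigr => g /eqP <-; rewrite cd.
Qed.

Lemma char_pair_map (V W : vectType 'F_2) (f : 'Hom(V, W))
    (c : {additive fin_vect V -> 'F_2}) (d : {additive fin_vect W -> 'F_2}) :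
  (forall v, c v = d (fin_lfun f v)) ->
  forall y, char_pair d (fmap RZinf f y) = char_pair c y.
Proof.
move=> cd y; have [n [u ->]] := limit_classP y.
have -> : fmap RZinf f (limit_class n u) = limit_class n (fmap PbarZ f u).
  rewrite /limit_class; etransitivity; first exact: colim_map_in.
  apply: (congr1 (@colim_in _ (fun n => RZ_incl n.+1 W) n)).
  exact: (quot_mapE (@augideal_map_power _ _ (fin_lfun f) n.+2)).
by rewrite !char_pair_class /bitclass (bitsum_map cd).
Qed.

Section DualBasis.
Variables (V : vectType 'F_2) (X : finZmodType).
Variable chi : X -> {additive fin_vect V -> 'F_2}.
Hypothesis chi_perfect : perfect chi.

Let chi0 g : chi 0 g = 0. Proof. exact: perfect0. Qed.

Lemma char_pair0 y : char_pair (chi 0) y = 0.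
Proof.
have [n [u ->]] := limit_classP y; rewrite char_pair_class /bitclass /bitsum.
by rewrite big1 // => g _; rewrite chi0 mulr0.
Qed.

(** The sign of (-2)^#|X| is absorbed in e, and one factor 2 is lost in passing from
    the transform to [bitsum]. *)
Lemma bitsum_delta x : x != 0 ->
  exists2 e, e \in @aug_power (fin_vect V) #|X| &
    forall y, bitsum (chi y) e = (2 ^ #|X|.-1)%N%:Z *+ (y == x).
Proof.
move=> x0; have [e eP eE] := fourier_delta chi_perfect x0.
exists (e *~ (-1) ^+ #|X|.-1); first exact: rpredMz.
move=> y; apply: (@mulfI _ (- 2)) => //; rewrite raddfMz /= mulrzAr -fourier_aug.
rewrite eE -mulrzr intz mulrnAl mulrnAr; congr (_ *+ _).
have /prednK {1}<- : (0 < #|X|)%N by apply/card_gt0P; exists 0.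
rewrite exprS -mulrA; congr (_ * _).
by rewrite -exprMn mulrNN mulr1 -natz natrX.
Qed.

(** The stage is chosen large enough for the factor 2^(#|X| - 1) of [bitsum_delta] to
    turn the generator of that stage into 1/2^(k+1), of which q is a multiple. *)
Lemma char_pair_delta x q : x != 0 ->
  exists y, forall x', char_pair (chi x') y = q *+ (x' == x).
Proof.
move=> x0; have [e _ eE] := bitsum_delta x0.
have [k qk] := prufer_tors q.
have [m ->] := proot_span (prufer_tors_mono (leqnSn k) qk).
exists (limit_class (#|X|.-1 + k) (e *+ m)) => x'.
rewrite char_pair_class /bitclass raddfMn /= eE.
case: eqP => _; last by rewrite !mulr0n mul0rn.
rewrite !mulr1n -mulr_natr natz mulrzA -!pmulrn.
by rewrite -addnS proot_mul.
Qed.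

Lemma char_pair_onto (phi : X -> Prufer2) : phi 0 = 0 ->
  exists y, forall x, char_pair (chi x) y = phi x.
Proof.
move=> phi0.
have /choice[s sE] x : exists y, forall x', char_pair (chi x') y = phi x *+ (x' == x).
  have [->|x0] := eqVneq x 0; last exact: char_pair_delta.
  by exists 0 => x'; rewrite phi0 mul0rn raddf0.
exists (\sum_x s x) => x; rewrite raddf_sum.
rewrite (eq_bigr (fun z => phi z *+ (x == z))) => [|z _]; last exact: sE.
rewrite (bigD1 x) //= eqxx mulr1n big1 ?addr0 // => z /negPf zx.
by rewrite eq_sym zx.
Qed.

(** If u / 2^n pairs to 0 with all x, then bitsum x u = m x * 2^(n+1), so that a
    power of 2 times u agrees, by Fourier injectivity, with a combination of the
    delta elements with coefficients m x * 2^(n+1).  As those elements lie in the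
    power #|X| of the augmentation ideal and doubling raises the power by one,
    this combination vanishes at a later stage. *)
Lemma char_pair_inj y : (forall x, char_pair (chi x) y = 0) -> y = 0.
Proof.
have [n [u ->]] := limit_classP y => u0.
have /choice[m mE] x : exists m, bitsum (chi x) u = m * (2 ^ n.+1)%N%:Z.
  have := u0 x; rewrite char_pair_class /bitclass => h.
  suff /dvdzP[m ->] : ((2 ^ n.+1)%N %| bitsum (chi x) u)%Z by exists m.
  rewrite dvdzE -proot_eq0.
  case: (bitsum _ u) h => b; rewrite ?NegzE ?mulrNz -pmulrn => /eqP //.
  by rewrite oppr_eq0.
pose N := #|X|.
have /choice[e eE] x : exists e, e \in @aug_power (fin_vect V) N /\
    forall y, bitsum (chi y) e = (2 ^ N.-1)%N%:Z *+ ((y == x) && (x != 0)).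
  have [->|x0] := eqVneq x 0.
    by exists 0; split=> [|z]; rewrite ?rpred0 // andbF raddf0.
  have [f fP fE] := bitsum_delta x0.
  by exists f; split=> // z; rewrite andbT.
have uE : u *+ 2 ^ N.-1 = \sum_x e x *~ m x *+ 2 ^ n.+1.
  apply: (bitsum_inj chi_perfect) => x.
  have eEx z : bitsum (chi x) (e z *~ m z *+ 2 ^ n.+1) =
      ((2 ^ N.-1)%N%:Z *+ ((x == z) && (z != 0))) *~ m z *+ 2 ^ n.+1.
    by rewrite raddfMn raddfMz /= (eE z).2.
  rewrite raddfMn raddf_sum (eq_bigr _ (fun z _ => eEx z)) (bigD1 x) //= eqxx.
  rewrite [X in _ = _ + X]big1 ?addr0 => [|z /negPf zx]; last first.
    by rewrite eq_sym zx mulr0n mul0rz mul0rn.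
  have [x0|_] := eqVneq x 0; last first.
    rewrite mE mulr1n -[LHS]mulr_natr -[RHS]mulr_natr -mulrzr intz !natz.
    by rewrite mulrAC [m x * _]mulrC.
  rewrite mulr0n mul0rz mul0rn /bitsum big1 ?mul0rn // => g _.
  by rewrite x0 chi0 mulr0.
rewrite -(limit_class_mul n N.-1) uE; apply: limit_class_power.
apply: rpred_sum => x _.
have [eP _] := eE x; rewrite addnC -addSn; apply: aug_power_mul_pow2.
by rewrite prednK; [exact: rpredMz | apply/card_gt0P; exists 0].
Qed.

End DualBasis.

(** * Functionals on the 2-adic augmentation ideal *)

Section TwoAdicFunctional.
Variable X : finZmodType.

Section Def.
Variable phi : X -> Prufer2.

Definition functional_term z (u : augideal X) : Prufer2 :=
  \sum_x zact z (phi x) *~ val u x.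

Fact functional_termDl z w u :
  functional_term (z + w) u = functional_term z u + functional_term w u.
Proof.
by rewrite -big_split; apply: eq_bigr => x _; rewrite zactDl mulrzDl.
Qed.

Fact functional_termDr z u w :
  functional_term z (u + w) = functional_term z u + functional_term z w.
Proof.
rewrite -big_split; apply: eq_bigr => x _ /=.
by rewrite -mulrzDr; congr (_ *~ _); exact: ffunE.
Qed.

(** The Z_2-linear functional with value phi x - phi 0 at [x] - [0]. *)
Definition functional : {additive tensor Zadic2 (augideal X) -> Prufer2} :=
  tensor_lift functional_termDl functional_termDr.

Lemma functional_tens z u :
  functional (tens z u) = \sum_x zact z (phi x) *~ val u x.
Proof. exact: (tensor_lift_tens functional_termDl functional_termDr). Qed.

Lemma functional_gaug z x : functional (tens z (gaug x)) = zact z (phi x - phi 0).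
Proof.
rewrite functional_tens.
under eq_bigr do rewrite !ffunE mulrzBr.
have sum1 y : \sum_i zact z (phi i) *~ (i == y)%:R = zact z (phi y).
  rewrite (bigD1 y) //= eqxx mulr1z big1 ?addr0 // => i /negPf iy.
  by rewrite iy mulr0z.
by rewrite sumrB !sum1 -raddfB.
Qed.

End Def.

Lemma functionalB phi psi t :
  functional (fun x => phi x - psi x) t = functional phi t - functional psi t.
Proof.
move: t; apply: tensor_ind => [s t hs ht|z u].
  rewrite !(raddfB (functional _)) hs ht !opprB addrACA [RHS]addrACA.
  by rewrite [- functional psi s + _]addrC.
rewrite !functional_tens -sumrB; apply: eq_bigr => x _.
by rewrite raddfB mulrzBl.
Qed.

Lemma tensor_gaug (t : tensor Zadic2 (augideal X)) :
  exists z : X -> Zadic2, t = \sum_x tens (z x) (gaug x).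
Proof.
move: t; apply: tensor_ind => [_ _ [z ->] [w ->]|z u].
  exists (fun x => z x - w x); rewrite -sumrB; apply: eq_bigr => x _.
  exact/esym/(raddfB (tensl (gaug x))).
exists (fun x => z *~ val u x); rewrite {1}[u]augidealE raddf_sum.
apply: eq_bigr => x _; rewrite raddfMz; exact/esym/(raddfMz (tensl (gaug x))).
Qed.

Lemma gaug0 : gaug (0 : X) = 0.
Proof. by apply/val_inj; rewrite /= subrr. Qed.

(** The elements [x] - [0] generate over Z_2, and on each Z_2-line continuity
    gives linearity by [Z2_hom_cont]. *)
Lemma continuous_functional (f : {additive tensor Zadic2 (augideal X) -> Prufer2}) k :
  (forall t, f (t *+ 2 ^ k) = 0) ->
  f =1 functional (fun x => f (tens Z2_one (gaug x))).
Proof.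
move=> fk; apply: tensor_ext => z u.
rewrite functional_tens {1}[u]augidealE !raddf_sum; apply: eq_bigr => x _.
rewrite !raddfMz; congr (_ *~ _).
apply: (Z2_hom_cont (f := f \o tensl (gaug x)) (k := k)) => w.
rewrite /= -[RHS](fk (tens w (gaug x))); congr (f _).
exact: (raddfMn (tensl (gaug x))).
Qed.

End TwoAdicFunctional.

Lemma functional_map (X Y : finZmodType) (F : {additive X -> Y}) (phi : Y -> Prufer2) t :
  functional phi (tensor_map Zadic2 (augideal_map F) t)
  = functional (fun x => phi (F x)) t.
Proof.
move: t; apply: tensor_ind => [s t hs ht|z u].
  by rewrite !(raddfB (functional _)) -hs -ht -raddfB -raddfB.
rewrite tensor_map_tens !functional_tens.
rewrite [RHS](partition_big F xpredT) //=; apply: eq_bigr => y _.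
by rewrite ffunE mulrz_sumr; apply: eq_bigr => x /eqP ->.
Qed.

(** * Vectors and covectors as characters of each other *)

Section DualCharacters.
Variable V : vectType 'F_2.

Definition covector_char_fun (l : fin_vect (dual_vect V)) (v : fin_vect V) : 'F_2 :=
  (l : 'Hom(V, ('F_2)^o)) v.
Fact covector_char_additive l : zmod_morphism (covector_char_fun l).
Proof. by move=> v w; exact: (raddfB (l : 'Hom(V, ('F_2)^o))). Qed.
HB.instance Definition _ l :=
  GRing.isZmodMorphism.Build (fin_vect V) 'F_2 (covector_char_fun l)
    (covector_char_additive l).
Definition covector_char l : {additive fin_vect V -> 'F_2} := covector_char_fun l.

Definition vector_char_fun (v : fin_vect V) (l : fin_vect (dual_vect V)) : 'F_2 :=
  covector_char l v.
Fact vector_char_additive v : zmod_morphism (vector_char_fun v).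
Proof.
move=> l m; rewrite /vector_char_fun.
rewrite -[LHS]/(((l : 'Hom(V, ('F_2)^o)) - (m : 'Hom(V, ('F_2)^o))) (v : V)).
by rewrite add_lfunE opp_lfunE.
Qed.
HB.instance Definition _ v :=
  GRing.isZmodMorphism.Build (fin_vect (dual_vect V)) 'F_2 (vector_char_fun v)
    (vector_char_additive v).
Definition vector_char v : {additive fin_vect (dual_vect V) -> 'F_2} :=
  vector_char_fun v.

Lemma covector_sep (l : fin_vect (dual_vect V)) :
  (forall v, covector_char l v = 0) -> l = 0.
Proof.
move=> l0; rewrite -[LHS]/(l : 'Hom(V, ('F_2)^o)) -[RHS]/(0 : 'Hom(V, ('F_2)^o)).
by apply/lfunP => v; rewrite zero_lfunE; exact: l0.
Qed.

Lemma vector_sep (v : fin_vect V) : (forall l, covector_char l v = 0) -> v = 0.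
Proof.
move=> v0; rewrite -[LHS]/(v : V) -[RHS]/(0 : V).
rewrite (coord_vbasis (memvf (v : V))) big1 // => i _.
pose l : dual_vect V := linfun (coord (vbasis {:V}) i : V -> ('F_2)^o).
have : l (v : V) = 0 by exact: (v0 l).
by rewrite lfunE /= => ->; rewrite scale0r.
Qed.

Lemma covector_perfect : perfect covector_char.
Proof.
split; [exact: vector_char_additive | exact: covector_sep | exact: vector_sep].
Qed.

Lemma vector_perfect : perfect vector_char.
Proof.
split; [|exact: vector_sep|exact: covector_sep].
by move=> l v w; rewrite /= /vector_char_fun raddfB.
Qed.

End DualCharacters.

Lemma covector_char_transpose (V W : vectType 'F_2) (f : 'Hom(V, W))
    (l : fin_vect (dual_vect W)) v :
  covector_char (fin_lfun (transpose f) l) v = covector_char l (fin_lfun f v).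
Proof.
rewrite -[LHS]/((transpose f (l : dual_vect W) : 'Hom(V, ('F_2)^o)) (v : V)).
by rewrite lfunE /= /transpose_fun comp_lfunE.
Qed.

(** * The two duality isomorphisms *)

Section LimitToDual.
Variable V : vectType 'F_2.

(** The formula z (x) ([l] - [0]) |-> z <y, l>. *)
Definition limit_functional (y : RZinf V) : D PbarZ2 V :=
  functional (fun l => char_pair (covector_char l) y).

Fact limit_functional_cont y : limit_functional y \in @adic_cont (PbarZ2 (dual_vect V)).
Proof.
have [k hk] := prufer_tors_fin (fun l => char_pair (covector_char l) y).
apply/asboolP; exists k; apply: tensor_ind => [s t hs ht|z u].
  by rewrite mulrnBl raddfB hs ht subrr.
rewrite raddfMn [X in X *+ _]functional_tens -sumrMnl big1 // => l _.
by rewrite pmulrn mulrzAC -pmulrn -(raddfMn (zact z)) hk raddf0 mul0rz.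
Qed.

Definition limit_to_dual (y : RZinf V) : Dadic PbarZ2 V :=
  exist (fun f => f \in @adic_cont (PbarZ2 (dual_vect V))) _ (limit_functional_cont y).

Fact limit_to_dual_additive : zmod_morphism limit_to_dual.
Proof.
move=> x y; apply/val_inj/additive_ext => t.
etransitivity; last exact: functionalB.
by congr (functional _ t); apply: funext => l; exact: raddfB.
Qed.
HB.instance Definition _ := GRing.isZmodMorphism.Build (RZinf V) (Dadic PbarZ2 V)
  limit_to_dual limit_to_dual_additive.

(** Both sides are the group of functions V^# -> Z/2^oo vanishing at 0: the limit by
    [char_pair_inj] and [char_pair_onto], the continuous functionals by their
    values on the elements 1 (x) ([l] - [0]). *)
Lemma limit_to_dual_bij : bijective limit_to_dual.
Proof.
have inj : injective limit_to_dual.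
  apply: raddf_inj => y /(congr1 val) y0.
  apply: (char_pair_inj (@covector_perfect V)) => l.
  have : functional (fun l => char_pair (covector_char l) y) (tens Z2_one (gaug l)) = 0.
    exact: (congr1 (fun f : D PbarZ2 V => f (tens Z2_one (gaug l))) y0).
  by rewrite functional_gaug zact1 (char_pair0 (@covector_perfect V)) subr0.
have surj f : exists y, limit_to_dual y = f.
  have /asboolP[k fk] := valP f.
  have [|y yE] := char_pair_onto (@covector_perfect V)
    (phi := fun l => val f (tens Z2_one (gaug l))).
    by rewrite gaug0 !raddf0.
  exists y; apply/val_inj/additive_ext => t.
  rewrite (continuous_functional fk t) /=.
  by congr (functional _ t); apply: funext => l; exact: yE.
have [g gK] := choice surj.
by exists g => // y; apply: inj; rewrite gK.
Qed.

End LimitToDual.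

Lemma limit_to_dual_natural (V W : vectType 'F_2) (f : 'Hom(V, W)) y :
  limit_to_dual (fmap RZinf f y) = fmap (Dadic PbarZ2) f (limit_to_dual y).
Proof.
apply/val_inj/additive_ext => t.
etransitivity; last exact/esym/(functional_map (fin_lfun (transpose f))).
congr (functional _ t); apply: funext => l /=.
by apply: char_pair_map => v; exact: covector_char_transpose.
Qed.

Section AdicToDual.
Variable V : vectType 'F_2.

(** The same formula with the roles of V and V^# exchanged, read as a function of
    the element of the limit. *)
Definition adic_functional (t : PbarZ2 V) (y : RZinf (dual_vect V)) : Prufer2 :=
  functional (fun v => char_pair (vector_char v) y) t.

Fact adic_functional_additive t : zmod_morphism (adic_functional t).
Proof.
move=> x y; etransitivity; last exact: functionalB.
by congr (functional _ t); apply: funext => v; exact: raddfB.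
Qed.
HB.instance Definition _ t := GRing.isZmodMorphism.Build (RZinf (dual_vect V)) Prufer2
  (adic_functional t) (adic_functional_additive t).

Definition adic_to_dual (t : PbarZ2 V) : D RZinf V := adic_functional t.

Fact adic_to_dual_additive : zmod_morphism adic_to_dual.
Proof. by move=> s t; apply: additive_ext => y; exact: raddfB. Qed.
HB.instance Definition _ := GRing.isZmodMorphism.Build (PbarZ2 V) (D RZinf V)
  adic_to_dual adic_to_dual_additive.

Lemma adic_functional_gaug (z : fin_vect V -> Zadic2) y :
  adic_functional (\sum_v tens (z v) (gaug v)) y =
  \sum_v zact (z v) (char_pair (vector_char v) y).
Proof.
rewrite /adic_functional raddf_sum; apply: eq_bigr => v _.
by rewrite [LHS]functional_gaug (char_pair0 (@vector_perfect V)) subr0.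
Qed.

(** The limit is the direct sum over v <> 0 of copies of Z/2^oo, and s is the
    inclusion of the copy of index v.  Including v = 0, with s = 0, avoids
    distinguishing that index in sums. *)
Lemma dual_basis (v : fin_vect V) : exists s : {additive Prufer2 -> RZinf (dual_vect V)},
  forall q w, char_pair (vector_char w) (s q) = q *+ ((w == v) && (v != 0)).
Proof.
have /choice[s sE] q : exists y, forall w,
    char_pair (vector_char w) y = q *+ ((w == v) && (v != 0)).
  have [v0|v0] := eqVneq v 0; first by exists 0 => w; rewrite andbF raddf0.
  have [y yE] := char_pair_delta (@vector_perfect V) q v0.
  by exists y => w; rewrite andbT.
have sB : zmod_morphism s.
  move=> p q; apply/eqP; rewrite -subr_eq0; apply/eqP.
  apply: (char_pair_inj (@vector_perfect V)) => w.
  by rewrite (raddfB (char_pair _)) (raddfB (char_pair _)) !sE mulrnBl subrr.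
pose sm := GRing.isZmodMorphism.Build _ _ s sB.
pose sa : {additive Prufer2 -> RZinf (dual_vect V)} := HB.pack s sm.
by exists sa.
Qed.

(** Restricting to the summands of [dual_basis] turns an element of either side into
    a family of 2-adic integers indexed by the nonzero v: for functionals on the
    limit this is [prufer_endo]. *)
Lemma adic_to_dual_bij : bijective adic_to_dual.
Proof.
have /choice[s sE] := dual_basis.
have inj : injective adic_to_dual.
  apply: raddf_inj => t t0; have [z tE] := tensor_gaug t.
  rewrite tE big1 // => v _; have [->|v0] := eqVneq v 0; first by rewrite gaug0 raddf0.
  suff -> : z v = 0 by exact: (raddf0 (tensl (gaug v))).
  apply: zact_faithful => q.
  have : adic_functional t (s v q) = 0.
    exact: (congr1 (fun f : D RZinf V => f (s v q)) t0).
  rewrite tE adic_functional_gaug (bigD1 v) // big1 ?addr0 => [|w /andP[_ /negPf wv]].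
    by rewrite (sE v) eqxx v0 /= mulr1n addr0.
  by rewrite (sE v) wv mulr0n raddf0.
have surj f : exists t, adic_to_dual t = f.
  have /choice[z zE] v := prufer_endo (f \o s v).
  exists (\sum_v tens (z v) (gaug v)); apply: additive_ext => y.
  etransitivity; first exact: adic_functional_gaug.
  have yE : y = \sum_v s v (char_pair (vector_char v) y).
    apply/eqP; rewrite -subr_eq0; apply/eqP.
    apply: (char_pair_inj (@vector_perfect V)) => w.
    rewrite (raddfB (char_pair _)) (raddf_sum (char_pair _)).
    rewrite [X in _ - X](eq_bigr _ (fun v _ => sE v _ w)) (bigD1 w) // eqxx.
    rewrite [X in _ - (_ + X)]big1 => [|v /andP[_ /negPf vw]]; last first.
      by rewrite eq_sym vw.
    have [->|_] := eqVneq w 0; last by rewrite addr0 subrr.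
    by rewrite (char_pair0 (@vector_perfect V)) mul0rn addr0 subrr.
  rewrite [in RHS]yE (raddf_sum f); apply: eq_bigr => v _.
  exact/esym/zE.
have [g gK] := choice surj.
by exists g => // y; apply: inj; rewrite gK.
Qed.

End AdicToDual.

Lemma adic_to_dual_natural (V W : vectType 'F_2) (f : 'Hom(V, W)) t :
  adic_to_dual (fmap PbarZ2 f t) = fmap (D RZinf) f (adic_to_dual t).
Proof.
apply: additive_ext => y.
etransitivity; first exact: (functional_map (fin_lfun f)).
congr (functional _ t); apply: funext => v /=.
apply/esym/char_pair_map => l.
exact/esym/covector_char_transpose.
Qed.

Theorem theorem3p14 : fiso RZinf (Dadic PbarZ2) /\ fiso PbarZ2 (D RZinf).
Proof.
split.
  exists limit_to_dual; split; first exact: limit_to_dual_bij.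
  exact: limit_to_dual_natural.
exists adic_to_dual; split; first exact: adic_to_dual_bij.
exact: adic_to_dual_natural.
Qed.
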